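(* Let $G$ be the fundamental group of a finite graph of groups with finitely generated virtually nilpotent vertex groups and finite edge groups. Let $\varphi$ be an endomorphism of $G$. Then there exists a constant $R_\varphi>0$ such that every $x\in\mathrm{Per}(\varphi)$ has period $\leq R_\varphi$.
   Context: For an endomorphism $\varphi$ of a group $G$, $\mathrm{Fix}(\varphi)=\{x\in G\mid \varphi(x)=x\}$ and the periodic subgroup is $\mathrm{Per}(\varphi)=\bigcup_{n\geq 1}\mathrm{Fix}(\varphi^n)$. The period of $x\in\mathrm{Per}(\varphi)$ is the least $n\geq 1$ such that $\varphi^n(x)=x$. A group is virtually nilpotent if it has a nilpotent subgroup of finite index. A graph (in the sense of Serre) consists of a nonempty vertex set $V$, an edge set $E$, a map $\alpha:E\to V$ (initial vertex) and a fixed-point-free involution $e\mapsto\bar e$ on $E$. A finite graph of groups $\mathcal{G}$ over a finite connected graph consists of groups $G_v$ ($v\in V$, vertex groups), groups $G_e$ ($e\in E$, edge groups) with $G_{\bar e}=G_e$, and monomorphisms $\alpha_e:G_e\to G_{\alpha(e)}$ ($e\in E$). Given a spanning tree $T\subseteq E$, the fundamental group $\pi_1(\mathcal{G},T)$ is the quotient of $(\ast_{v\in V}G_v)\ast F_E$ ($F_E$ free on $E$) by the normal subgroup generated by $e\bar e$ ($e\in E$), $t$ ($t\in T$), and $e^{-1}\alpha_e(g)\,e\,\alpha_{\bar e}(g)^{-1}$ ($e\in E$, $g\in G_e$); up to isomorphism it does not depend on $T$. *)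

(* Defs.v *)
From HB Require Import structures.
From mathcomp Require Import all_boot generic_quotient.
From mathcomp Require Import boolp classical_sets functions cardinality.

Set Implicit Arguments.
Unset Strict Implicit.
Unset Printing Implicit Defensive.

Local Open Scope classical_set_scope.
Local Open Scope group_scope.
Local Open Scope quotient_scope.

Section Subgroups.
Variable G : groupType.
Implicit Types A H : set G.

Definition is_subgroup H : Prop :=
  [/\ H 1, (forall x y, H x -> H y -> H (x * y)) & forall x, H x -> H x^-1].

Definition is_normal_subgroup H : Prop :=
  is_subgroup H /\ forall x y, H x -> H (x ^ y).

Definition generated A : set G := smallest is_subgroup A.

Definition normal_closure A : set G := smallest is_normal_subgroup A.

Definition finitely_generated : Prop :=
  exists2 A : set G, finite_set A & generated A = [set: G].

Definition finite_index H : Prop :=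
  finite_set [set [set x * h | h in H] | x in [set: G]].

Fixpoint lower_central H (n : nat) : set G :=
  if n is m.+1 then
    generated [set z | exists x y, [/\ lower_central H m x, H y & z = [~ x, y]]]
  else H.

Definition nilpotent_subgroup H : Prop :=
  is_subgroup H /\ exists n, lower_central H n = [set 1].

Definition virtually_nilpotent : Prop :=
  exists2 H : set G, nilpotent_subgroup H & finite_index H.

Lemma normal_closureP A : is_normal_subgroup (normal_closure A).
Proof.
split; [split=> [K [[[]]] // |x y Hx Hy K KA|x Hx K KA]|move=> x y Hx K KA].
- by case: (KA) => [[[_ KM _] _] _]; apply: KM; [exact: Hx | exact: Hy].
- by case: (KA) => [[[_ _ KV] _] _]; apply: KV; exact: Hx.
- by case: (KA) => [[_ KJ] _]; apply: KJ; exact: Hx.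
Qed.

Lemma normal_closure1 A : normal_closure A 1.
Proof. by have [[]] := normal_closureP A. Qed.

Lemma normal_closureM A x y :
  normal_closure A x -> normal_closure A y -> normal_closure A (x * y).
Proof. by have [[_ NM _] _] := normal_closureP A; exact: NM. Qed.

Lemma normal_closureV A x : normal_closure A x -> normal_closure A x^-1.
Proof. by have [[_ _ NV] _] := normal_closureP A; exact: NV. Qed.

Lemma normal_closureJ A x y : normal_closure A x -> normal_closure A (x ^ y).
Proof. by have [_ NJ] := normal_closureP A; exact: NJ. Qed.

End Subgroups.

Section Quotient.
Variables (G : groupType) (A : set G).

Definition relator_equiv : rel G :=
  fun x y => `[< normal_closure A (x^-1 * y) >].

Lemma relator_equiv_class : equiv_class_of relator_equiv.
Proof.
split=> [x|x y|y x z].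
- by apply/asboolP; rewrite mulVg; exact: normal_closure1.
- by apply/asboolP/asboolP => /normal_closureV; rewrite invgM invgK.
- move=> /asboolP xy /asboolP yz; apply/asboolP.
  by have := normal_closureM xy yz; rewrite -mulgA mulVKg.
Qed.

Canonical relator_equiv_rel := EquivRelPack relator_equiv_class.

Definition quotient := {eq_quot relator_equiv}.
HB.instance Definition _ := Choice.on quotient.

Definition quotient_pi (x : G) : quotient := \pi_{eq_quot relator_equiv} x.

Lemma quotient_piP x y :
  quotient_pi x = quotient_pi y <-> normal_closure A (x^-1 * y).
Proof.
by split=> [/eqP|h]; last apply/eqP; rewrite /quotient_pi eqmodE;
  [move/asboolP | apply/asboolP].
Qed.

Lemma quotient_reprK (a : quotient) : quotient_pi (repr a) = a.
Proof. exact: reprK. Qed.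

Definition quotient_mul (a b : quotient) := quotient_pi (repr a * repr b).
Definition quotient_inv (a : quotient) := quotient_pi (repr a)^-1.

Lemma quotient_piM x y :
  quotient_pi (x * y) = quotient_mul (quotient_pi x) (quotient_pi y).
Proof.
rewrite /quotient_mul; set x' := repr _; set y' := repr (quotient_pi y).
have /quotient_piP hx : quotient_pi x = quotient_pi x' by rewrite quotient_reprK.
have /quotient_piP hy : quotient_pi y = quotient_pi y' by rewrite quotient_reprK.
apply/quotient_piP.
have -> : (x * y)^-1 * (x' * y') = (x^-1 * x') ^ y * (y^-1 * y').
  by rewrite /conjg !invgM -!mulgA mulVKg.
by apply: normal_closureM => //; exact: normal_closureJ.
Qed.

Lemma quotient_piV x : quotient_pi x^-1 = quotient_inv (quotient_pi x).
Proof.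
rewrite /quotient_inv; set x' := repr _.
have /quotient_piP/normal_closureV hx : quotient_pi x = quotient_pi x'.
  by rewrite quotient_reprK.
apply/quotient_piP; have := normal_closureJ x^-1 hx.
by rewrite /conjg !invgM !invgK -!mulgA mulgV mulg1.
Qed.

Lemma quotient_mulA : associative quotient_mul.
Proof.
move=> a b c; rewrite -(quotient_reprK a) -(quotient_reprK b) -(quotient_reprK c).
by rewrite -!quotient_piM mulgA.
Qed.

Lemma quotient_mul1 : left_id (quotient_pi 1) quotient_mul.
Proof. by move=> a; rewrite -(quotient_reprK a) -quotient_piM mul1g. Qed.

Lemma quotient_mulg1 : right_id (quotient_pi 1) quotient_mul.
Proof. by move=> a; rewrite -(quotient_reprK a) -quotient_piM mulg1. Qed.

Lemma quotient_mulV : left_inverse (quotient_pi 1) quotient_inv quotient_mul.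
Proof.
by move=> a; rewrite -(quotient_reprK a) -quotient_piV -quotient_piM mulVg.
Qed.

Lemma quotient_mulgV : right_inverse (quotient_pi 1) quotient_inv quotient_mul.
Proof.
by move=> a; rewrite -(quotient_reprK a) -quotient_piV -quotient_piM mulgV.
Qed.

HB.instance Definition _ := isGroup.Build quotient
  quotient_mulA quotient_mul1 quotient_mulg1 quotient_mulV quotient_mulgV.

End Quotient.

(* Words in the letters (x, true) = x and (x, false) = x^-1, modulo insertion
   and deletion of adjacent pairs of mutually inverse letters *)
Section FreeGroup.
Variable X : choiceType.
Local Notation word := (seq (X * bool)).

Inductive free_eq : word -> word -> Prop :=
| free_eq_refl w : free_eq w w
| free_eq_sym w1 w2 : free_eq w1 w2 -> free_eq w2 w1
| free_eq_trans w1 w2 w3 : free_eq w1 w2 -> free_eq w2 w3 -> free_eq w1 w3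
| free_eq_cancel u x b v : free_eq (u ++ [:: (x, b), (x, ~~ b) & v]) (u ++ v).

Definition free_equiv : rel word := fun w1 w2 => `[< free_eq w1 w2 >].

Lemma free_equiv_class : equiv_class_of free_equiv.
Proof.
split=> [x|x y|y x z].
- by apply/asboolP; exact: free_eq_refl.
- by apply/asboolP/asboolP; exact: free_eq_sym.
- by move=> /asboolP xy /asboolP yz; apply/asboolP; exact: free_eq_trans xy yz.
Qed.

Canonical free_equiv_rel := EquivRelPack free_equiv_class.

Definition free_group := {eq_quot free_equiv}.
HB.instance Definition _ := Choice.on free_group.

Definition free_pi (w : word) : free_group := \pi_{eq_quot free_equiv} w.

Definition free_gen (x : X) : free_group := free_pi [:: (x, true)].

Lemma free_piP w1 w2 : free_pi w1 = free_pi w2 <-> free_eq w1 w2.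
Proof.
by split=> [/eqP|h]; last apply/eqP; rewrite /free_pi eqmodE;
  [move/asboolP | apply/asboolP].
Qed.

Lemma free_reprK (a : free_group) : free_pi (repr a) = a.
Proof. exact: reprK. Qed.

Lemma free_eq_cat u1 u2 v1 v2 :
  free_eq u1 u2 -> free_eq v1 v2 -> free_eq (u1 ++ v1) (u2 ++ v2).
Proof.
move=> hu hv; apply: (@free_eq_trans _ (u2 ++ v1)).
  elim: hu => [w|w1 w2 _|w1 w2 w3 _ h1 _ h2|u x b v].
  - exact: free_eq_refl.
  - exact: free_eq_sym.
  - exact: free_eq_trans h1 h2.
  - by rewrite -!catA /=; exact: free_eq_cancel.
elim: hv => [w|w1 w2 _|w1 w2 w3 _ h1 _ h2|u x b v].
- exact: free_eq_refl.
- exact: free_eq_sym.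
- exact: free_eq_trans h1 h2.
- by rewrite !catA; exact: free_eq_cancel.
Qed.

Definition word_inv (w : word) : word := rev [seq (l.1, ~~ l.2) | l <- w].

Lemma word_invK : involutive word_inv.
Proof.
move=> w; rewrite /word_inv map_rev revK -map_comp -[RHS]map_id.
by apply: eq_map => -[x b] /=; rewrite negbK.
Qed.

Lemma free_eq_inv w1 w2 : free_eq w1 w2 -> free_eq (word_inv w1) (word_inv w2).
Proof.
elim=> [w|{}w1 {}w2 _|{}w1 {}w2 w3 _ h1 _ h2|u x b v].
- exact: free_eq_refl.
- exact: free_eq_sym.
- exact: free_eq_trans h1 h2.
- rewrite /word_inv !map_cat !rev_cat /= !rev_cons -!cats1 -!catA negbK.
  exact: free_eq_cancel.
Qed.

Lemma free_eq_mulV w : free_eq (w ++ word_inv w) [::].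
Proof.
elim: w => [|[x b] w IHw]; first exact: free_eq_refl.
rewrite /word_inv /= rev_cons -cats1 catA.
apply: (@free_eq_trans _ ([:: (x, b)] ++ [::] ++ [:: (x, ~~ b)])).
  rewrite -[_ :: _]/([:: (x, b)] ++ (w ++ word_inv w) ++ [:: (x, ~~ b)]).
  apply: free_eq_cat; first exact: free_eq_refl.
  by apply: free_eq_cat => //; exact: free_eq_refl.
exact: (@free_eq_cancel [::] x b [::]).
Qed.

Definition free_mul (a b : free_group) := free_pi (repr a ++ repr b).
Definition free_inv (a : free_group) := free_pi (word_inv (repr a)).

Lemma free_piM w1 w2 : free_pi (w1 ++ w2) = free_mul (free_pi w1) (free_pi w2).
Proof. by apply/free_piP/free_eq_cat; apply/free_piP; rewrite free_reprK. Qed.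

Lemma free_piV w : free_pi (word_inv w) = free_inv (free_pi w).
Proof. by apply/free_piP/free_eq_inv; apply/free_piP; rewrite free_reprK. Qed.

Lemma free_mulA : associative free_mul.
Proof.
move=> a b c; rewrite -(free_reprK a) -(free_reprK b) -(free_reprK c).
by rewrite -!free_piM catA.
Qed.

Lemma free_mul1 : left_id (free_pi [::]) free_mul.
Proof. by move=> a; rewrite -(free_reprK a) -free_piM. Qed.

Lemma free_mulg1 : right_id (free_pi [::]) free_mul.
Proof. by move=> a; rewrite -(free_reprK a) -free_piM cats0. Qed.

Lemma free_mulgV : right_inverse (free_pi [::]) free_inv free_mul.
Proof.
move=> a; rewrite -(free_reprK a) -free_piV -free_piM.
exact/free_piP/free_eq_mulV.
Qed.

Lemma free_mulV : left_inverse (free_pi [::]) free_inv free_mul.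
Proof.
move=> a; rewrite -(free_reprK a) -free_piV -free_piM.
by apply/free_piP; rewrite -{2}[repr a]word_invK; exact: free_eq_mulV.
Qed.

HB.instance Definition _ := isGroup.Build free_group
  free_mulA free_mul1 free_mulg1 free_mulV free_mulgV.

End FreeGroup.

(* Presented by all elements of the H i, subject to the multiplication table
   of each H i *)
Section FreeProduct.
Variables (I : choiceType) (H : I -> groupType).

Definition free_product_gen (i : I) (x : H i) : free_group {i : I & H i} :=
  free_gen (Tagged H x).

Definition free_product_relators : set (free_group {i : I & H i}) :=
  [set r | exists i (x y : H i), r = free_product_gen x * free_product_gen y
                                     * (free_product_gen (x * y))^-1].

Definition free_product := quotient free_product_relators.
HB.instance Definition _ := Group.on free_product.

Definition free_product_in (i : I) (x : H i) : free_product :=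
  quotient_pi free_product_relators (free_product_gen x).

End FreeProduct.

Record finite_graph := FiniteGraph {
  vertex : finType;
  edge : finType;
  source : edge -> vertex;
  ebar : edge -> edge;
  vertex_nonempty : 0 < #|vertex|;
  ebarK : involutive ebar;
  ebar_neq : forall e, ebar e != e }.

Section GraphTheory.
Variable Gamma : finite_graph.
Implicit Types (T : {set edge Gamma}) (e f : edge Gamma) (u v : vertex Gamma).

Definition target e : vertex Gamma := source (ebar e).

Definition adjacent_in T : rel (vertex Gamma) :=
  fun u v => [exists e in T, (source e == u) && (target e == v)].

Definition connected_in T : Prop := forall u v, connect (adjacent_in T) u v.

Definition connected_graph : Prop := connected_in [set: edge Gamma].

(* The backtracking condition f != ebar e also applies at the closing vertex,
   so p = [:: e; ebar e] is not a circuit, whereas a loop [:: e] is one. *)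
Definition is_circuit (p : seq (edge Gamma)) : Prop :=
  [/\ p != [::],
      cycle (fun e f => (target e == source f) && (f != ebar e)) p &
      uniq [seq source e | e <- p]].

Definition spanning_tree T : Prop :=
  [/\ forall e, e \in T -> ebar e \in T,
      connected_in T &
      forall p, is_circuit p -> ~ {subset p <= T}].

End GraphTheory.

Record graph_of_groups := GraphOfGroups {
  gog_graph :> finite_graph;
  gog_connected : connected_graph gog_graph;
  vgroup : vertex gog_graph -> groupType;
  egroup : edge gog_graph -> groupType;
  egroup_bar : forall e, egroup (ebar e) = egroup e;
  emono : forall e, UMagmaMorphism.type (egroup e) (vgroup (source e));
  emono_inj : forall e, injective (emono e) }.

Section FundamentalGroup.
Variables (GG : graph_of_groups) (T : {set edge GG}).

Definition to_ebar (e : edge GG) (g : egroup e) : egroup (ebar e) :=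
  eq_rect_r (fun K : groupType => K : Type) g (egroup_bar e).

(* ( *_v G_v) * F_E is built as a single free product, indexed by option V,
   whose factor at None is F_E. *)
Definition factor (i : option (vertex GG)) : groupType :=
  if i is Some v then vgroup v else free_group (edge GG).

Definition vertex_elt (v : vertex GG) (g : vgroup v) : free_product factor :=
  @free_product_in _ factor (Some v) g.

Definition edge_elt (e : edge GG) : free_product factor :=
  @free_product_in _ factor None (free_gen e).

Definition pi1_relators : set (free_product factor) :=
  [set edge_elt e * edge_elt (ebar e) | e in [set: edge GG]]
  `|` [set edge_elt t | t in [set` T]]
  `|` [set r | exists e (g : egroup e),
         r = (edge_elt e)^-1 * vertex_elt (emono e g) * edge_elt e
             * (vertex_elt (emono (ebar e) (to_ebar g)))^-1].

Definition pi1 := quotient pi1_relators.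
HB.instance Definition _ := Group.on pi1.

End FundamentalGroup.

Section Periodic.
Variables (G : groupType) (phi : G -> G).

Definition Fix (f : G -> G) : set G := [set x | f x = x].

Definition Per : set G :=
  \bigcup_(n in [set n : nat | (0 < n)%N]) Fix (iter n phi).

Definition is_period (x : G) (n : nat) : Prop :=
  [/\ (0 < n)%N, iter n phi x = x &
      forall m, (0 < m)%N -> iter m phi x = x -> (n <= m)%N].

End Periodic.

(* Main.v *)
From HB Require Import structures.
From mathcomp Require Import all_boot all_fingroup all_algebra generic_quotient.
From mathcomp Require Import boolp classical_sets functions cardinality.
Require Import Defs.
From mathcomp Require Import cyclic ring.
Set Implicit Arguments.
Unset Strict Implicit.
Unset Printing Implicit Defensive.
Import GRing.Theory.
Local Open Scope classical_set_scope.
Local Open Scope group_scope.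

(** The proof bounds periods by means of residual properties. Call a function [F]
    from a group [H] to a field [K] polynomial of degree less than [d] if every
    [d]-fold iterated difference of [F] vanishes, and call [H] separated over [K]
    if polynomial functions tell its elements from [1]; for a finitely generated
    group and a finite field of characteristic [p] this means being residually a
    finite [p]-group.

    Separation in two characteristics bounds periods ([bounded_periods]). Let
    [phi] be an endomorphism of a finitely generated group [G] preserving a
    subgroup [H] of finite index that is separated in the characteristics [p] and
    [q]. There are finitely many homomorphisms from [H] to [K], so that on them,
    hence on the largest elementary abelian [p]-quotient of [H], some power [psi]
    of [phi] is idempotent. Then [F \o psi \o psi - F \o psi] has smaller degree
    than [F] ([degree_lt_drop]), and along the orbit of a periodic point [F] has a
    period that is a power of [p] ([degree_lt_orbit]). As the functions [F]
    separate, the period of a point of [H] under [phi] divides [N * p ^ a], and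
    likewise [N' * q ^ b], with [N] and [N'] independent of the point; hence it
    divides [N * N']. Finally [H] is torsion-free and of finite index, which
    extends the bound to [G].

    It remains to find such an [H] in the fundamental group. It is the common
    kernel of all homomorphisms to a suitable finite group, which makes it
    invariant under every endomorphism.

    For the vertex groups, a finitely generated nilpotent group is built from the
    trivial group by successive extensions by cyclic groups. If [M] is virtually
    separated and normalized by [t], then polynomial functions on a characteristic
    subgroup [W] of finite index extend to [W <s>] for a power [s] of [t] that
    acts trivially on the homomorphisms from [W] to the fields
    ([virtually_separated_cyclic_ext], [virtually_nilpotent_separated]).

    For the passage to the graph of groups, let the vertex groups act on a finite
    group [R] by right multiplication, through homomorphisms with separated
    kernels. The kernels are torsion-free, so that the finite edge groups act
    freely, and the actions of an edge group from both ends are isomorphic. Keeping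
    track of the kernels and of the crossings of edges turns this into a
    homomorphism from the fundamental group to the wreath product of the
    permutations of [R] with a free product, whose factors are the kernels and
    copies of the additive group of [K], one for each edge and coset of its edge
    group. This is the algebraic form
    of a covering space argument: a reduced word in the graph of groups is mapped
    to a reduced word in the free product ([walk_coefficient]). Reduced words in a
    free product of separated groups are told from [1] by polynomial functions,
    which are obtained by gluing those of the factors ([reduced_separated]). So
    the elements that fix [R] pointwise are separated ([pi1_core_separated]). *)

(** * Polynomial functions on a group *)

Section Degree.
Variables (G : groupType) (K : zmodType).
Implicit Types (H : set G) (F : G -> K) (d : nat).

Definition diff (h : G) F : G -> K := fun x => (F (x * h)%g - F x)%R.

(** For a subgroup [H] and values in a field this says that the linear extension
    of [F] to the group algebra of [H] kills the [d]-th power of the augmentation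
    ideal. Only the values of [F] on [H] matter, so that subgroups need not be
    made into types. *)
Fixpoint degree_lt H d F : Prop :=
  if d is e.+1 then forall h, H h -> degree_lt H e (diff h F)
  else forall x, H x -> F x = 0%R.

Lemma degree_lt_ext H d F F' : F =1 F' -> degree_lt H d F -> degree_lt H d F'.
Proof. by move=> /funext ->. Qed.

Section Subgroup.
Variable H : set G.
Hypothesis sgH : is_subgroup H.

Lemma subgroup1 : H 1. Proof. by case: sgH. Qed.
Lemma subgroupM x y : H x -> H y -> H (x * y).
Proof. by case: sgH => _ HM _; exact: HM. Qed.
Lemma subgroupV x : H x -> H x^-1.
Proof. by case: sgH => _ _; apply. Qed.
Lemma subgroupVl x y : H x -> H y -> H (x^-1 * y).
Proof. by move=> Hx Hy; apply: subgroupM => //; exact: subgroupV. Qed.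
Lemma subgroupX x n : H x -> H (x ^+ n).
Proof.
move=> Hx; elim: n => [|n IHn]; first by rewrite expg0; exact: subgroup1.
by rewrite expgS; exact: subgroupM.
Qed.
Lemma subgroupMr x y : H y -> H (x * y) -> H x.
Proof.
by move=> Hy Hxy; rewrite -(mulgK y x); apply: subgroupM => //; exact: subgroupV.
Qed.

Lemma eq_degree_lt d F F' :
  (forall x, H x -> F x = F' x) -> degree_lt H d F -> degree_lt H d F'.
Proof.
elim: d F F' => [|d IHd] F F' eqF.
  by move=> F0 x Hx; rewrite -eqF //; exact: F0.
move=> dF h Hh; apply: IHd (dF h Hh) => x Hx.
by rewrite /diff !eqF //; exact: subgroupM.
Qed.

Lemma degree_lt_zero d : degree_lt H d (fun=> 0%R).
Proof.
elim: d => [//|d IHd] h Hh.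
by apply: degree_lt_ext IHd => x; rewrite /diff subrr.
Qed.

Lemma degree_lt_const d a : degree_lt H d.+1 (fun=> a).
Proof.
by move=> h _; apply: degree_lt_ext (degree_lt_zero d) => x; rewrite /diff subrr.
Qed.

Lemma degree_ltD d F F' : degree_lt H d F -> degree_lt H d F' ->
  degree_lt H d (fun x => F x + F' x)%R.
Proof.
elim: d F F' => [|d IHd] F F' dF dF' x Hx; first by rewrite dF // dF' // addr0.
apply: degree_lt_ext (IHd _ _ (dF x Hx) (dF' x Hx)) => y.
by rewrite /diff opprD addrACA.
Qed.

Lemma degree_ltN d F : degree_lt H d F -> degree_lt H d (fun x => - F x)%R.
Proof.
elim: d F => [|d IHd] F dF x Hx; first by rewrite dF // oppr0.
by apply: degree_lt_ext (IHd _ (dF x Hx)) => y; rewrite /diff opprD.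
Qed.

Lemma degree_ltS d F : degree_lt H d F -> degree_lt H d.+1 F.
Proof.
elim: d F => [|d IHd] F dF h Hh; last exact/IHd/dF.
by move=> x Hx; rewrite /diff !dF ?subrr //; exact: subgroupM.
Qed.

Lemma degree_lt_leq d e F : (d <= e)%N -> degree_lt H d F -> degree_lt H e F.
Proof.
by move=> /subnK <-; elim: (e - d)%N => [//|n IHn] /IHn; exact: degree_ltS.
Qed.

Lemma degree_lt_diff d h F : H h -> degree_lt H d F -> degree_lt H d.-1 (diff h F).
Proof.
case: d => [|d] Hh; last exact.
by move=> F0 x Hx; rewrite /diff !F0 ?subrr //; exact: subgroupM.
Qed.

Lemma degree_lt_shiftr d h F : H h -> degree_lt H d F ->
  degree_lt H d (fun x => F (x * h)).
Proof.
move=> Hh dF; have dF' : degree_lt H d (diff h F).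
  by apply: degree_lt_leq (degree_lt_diff Hh dF); exact: leq_pred.
by apply: degree_lt_ext (degree_ltD dF' dF) => x; rewrite /diff subrK.
Qed.

Lemma degree_lt_shiftl d h F : H h -> degree_lt H d F ->
  degree_lt H d (fun x => F (h * x)).
Proof.
move=> Hh; elim: d F => [|d IHd] F dF x Hx; first by rewrite dF //; exact: subgroupM.
by apply: degree_lt_ext (IHd _ (dF x Hx)) => y; rewrite /diff mulgA.
Qed.

Lemma degree_lt_sub (H' : set G) d F :
  H' `<=` H -> degree_lt H d F -> degree_lt H' d F.
Proof.
move=> sH'; elim: d F => [|d IHd] F dF x /sH' Hx; first exact: dF.
exact/IHd/dF.
Qed.

(** By [diff (x * y) F z = diff y F (z * x) + diff x F z], the directions in
    which the increment of [F] has degree less than [d] form a subgroup. *)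
Lemma degree_lt_gen (A : set G) d F : (forall h, H h -> generated A h) ->
  (forall a, A a -> degree_lt H d (diff a F)) -> A `<=` H -> degree_lt H d.+1 F.
Proof.
move=> genA dA sAH h /genA/(_ [set h | H h /\ degree_lt H d (diff h F)]).
case=> // {h}; split=> [|a Aa]; last by split; [exact: sAH|exact: dA].
split=> [|x y [Hx dx] [Hy dy]|x [Hx dx]].
- split; first exact: subgroup1.
  by apply: degree_lt_ext (degree_lt_zero d) => x; rewrite /diff mulg1 subrr.
- split; first exact: subgroupM.
  apply: degree_lt_ext (degree_ltD (degree_lt_shiftr Hx dy) dx) => z.
  by rewrite /diff mulgA addrA subrK.
- split; first exact: subgroupV.
  apply: degree_lt_ext (degree_ltN (degree_lt_shiftr (subgroupV Hx) dx)) => z.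
  by rewrite /diff mulgVK opprB.
Qed.

End Subgroup.

(** For a finitely generated [H] and a finite field [K] of characteristic [p],
    this means that [H] is residually a finite [p]-group. Polynomial functions
    are easier to build and to transport than finite quotients. *)
Definition separated H : Prop := forall h, H h -> h <> 1 ->
  exists d F, degree_lt H d F /\ F h <> F 1.

Lemma separated_sub (H H' : set G) : H' `<=` H -> separated H -> separated H'.
Proof.
move=> sH' sepH h H'h h1; have [d [F [dF Fh]]] := sepH h (sH' h H'h) h1.
by exists d, F; split=> //; exact: degree_lt_sub dF.
Qed.

End Degree.

Definition hom_on (G R : groupType) (H : set G) (chi : G -> R) : Prop :=
  forall x y, H x -> H y -> chi (x * y) = chi x * chi y.

Section DegreeComp.
Variables (G G' : groupType) (K : zmodType) (H : set G) (H' : set G').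

Lemma degree_lt_comp (f : G -> G') d (F : G' -> K) : is_subgroup H ->
  hom_on H f -> (forall x, H x -> H' (f x)) ->
  degree_lt H' d F -> degree_lt H d (F \o f).
Proof.
move=> sgH fM fH; elim: d F => [|d IHd] F dF x Hx; first exact/dF/fH.
apply: eq_degree_lt (IHd _ (dF _ (fH x Hx))) => // y Hy.
by rewrite /diff /= fM.
Qed.

End DegreeComp.

(** * Finite generation and finite index *)

Lemma pigeonhole (X : finType) (v : nat -> X) :
  exists i j, [/\ (i < j)%N, (j <= #|X|)%N & v i = v j].
Proof.
have /injectivePn[i [j ij eqv]] : ~~ injectiveb (fun i : 'I_#|X|.+1 => v i).
  by apply/negP => /injectiveP/leq_card; rewrite card_ord ltnn.
case: (ltngtP i j) => [ltij|ltji|/val_inj eqij].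
- by exists i, j; split; rewrite // -ltnS.
- by exists j, i; split; rewrite // -ltnS.
- by rewrite eqij eqxx in ij.
Qed.

Section Generation.
Variable G : groupType.
Implicit Types (A H L M : set G) (s : seq G).

Lemma generated_subgroup A : is_subgroup (generated A).
Proof.
split=> [L [[L1 _ _] _] //|x y gx gy L LA|x gx L LA]; have [[_ LM LV] _] := LA.
- by apply: LM; [exact: gx|exact: gy].
- by apply: LV; exact: gx.
Qed.

Lemma sub_generated A : A `<=` generated A.
Proof. by move=> x Ax L [_]; apply. Qed.

Lemma generated_min A L : is_subgroup L -> A `<=` L -> generated A `<=` L.
Proof. by move=> sgL AL x; apply. Qed.

Definition fingen M : Prop := exists s, M = generated [set` s].

Lemma fingen_subgroup M : fingen M -> is_subgroup M.
Proof. by case=> s ->; exact: generated_subgroup. Qed.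

(** Labels that tell the left cosets of [L] in [M] apart suffice to express that
    the index is finite, and compose more easily than sets of cosets. *)
Definition fin_index M L : Prop := exists (T : finType) (f : G -> T),
  forall x y, M x -> M y -> f x = f y -> L (x^-1 * y).

Lemma fin_index_trans M L L' : is_subgroup M -> is_subgroup L -> L `<=` M ->
  fin_index M L -> fin_index L L' -> fin_index M L'.
Proof.
move=> sgM sgL sLM [T [f fP]] [T' [f' fP']].
pose r t := xget 1 [set x | M x /\ f x = t].
have rP x : M x -> M (r (f x)) /\ f (r (f x)) = f x.
  by move=> Mx; apply: (@xgetI _ 1 [set y | M y /\ f y = f x] x).
have Lr x : M x -> L ((r (f x))^-1 * x).
  by move=> Mx; have [Mr fr] := rP x Mx; exact: fP.
exists (T * T')%type, (fun x => (f x, f' ((r (f x))^-1 * x))) => x y Mx My [].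
move=> fxy; have:= Lr x Mx; have:= Lr y My; rewrite -fxy => Ly Lx.
by move=> /(fP' _ _ Lx Ly); rewrite invgM invgK -mulgA mulVKg.
Qed.

(** Schreier's lemma: with [rho] choosing coset representatives, the elements
    [(rho (a * r))^-1 * (a * r)] generate, since the union of the cosets
    [r * L0] of the subgroup [L0] they generate is stable under left
    multiplication by the generators [a] of [M]. *)
Lemma fingen_fin_index M L : fingen M -> is_subgroup L -> L `<=` M ->
  fin_index M L -> fingen L.
Proof.
move=> fgM sgL sLM [T [f fP]]; have sgM := fingen_subgroup fgM.
case: fgM => s defM.
pose r t := xget 1 [set x | M x /\ f x = t].
pose rho x := if `[< L x >] then 1 else r (f x).
have rhoL x : L x -> rho x = 1 by rewrite /rho => Lx; case: asboolP.
have rP x : M x -> M (r (f x)) /\ f (r (f x)) = f x.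
  by move=> Mx; apply: (@xgetI _ 1 [set y | M y /\ f y = f x] x).
have rhoM x : M x -> M (rho x).
  rewrite /rho => Mx; case: asboolP => _; first exact: subgroup1.
  by case: (rP x Mx).
have rhoP x : M x -> L ((rho x)^-1 * x).
  rewrite /rho => Mx; case: asboolP => [Lx|_]; first by rewrite invg1 mul1g.
  by have [Mr fr] := rP x Mx; exact: fP.
have rho_mem x : rho x \in 1 :: [seq r t | t <- enum T].
  rewrite inE /rho; case: asboolP => _; first by rewrite eqxx.
  by rewrite (map_f r) ?mem_enum ?orbT.
pose reps := [seq x <- 1 :: [seq r t | t <- enum T] | `[< M x >]].
pose gens := [seq (rho (a * x))^-1 * (a * x) | a <- s ++ [seq a^-1 | a <- s],
  x <- reps].
have Ms a : a \in s -> M a by move=> sa; rewrite defM; exact: sub_generated.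
have Ms' a : a \in s ++ [seq a^-1 | a <- s] -> M a.
  rewrite mem_cat => /orP[/Ms //|/mapP[b sb ->]].
  by apply: subgroupV => //; exact: Ms.
exists gens; apply/seteqP; split; last first.
  apply: generated_min => // x /= /allpairsP[[a y]] /= [sa].
  rewrite mem_filter => /andP[/asboolP My _] ->.
  by apply: rhoP; apply: subgroupM => //; exact: Ms'.
set L0 := generated _; have sgL0 : is_subgroup L0 by exact: generated_subgroup.
have sL0 : L0 `<=` L.
  apply: generated_min => // x /= /allpairsP[[a y]] /= [sa].
  rewrite mem_filter => /andP[/asboolP My _] ->.
  by apply: rhoP; apply: subgroupM => //; exact: Ms'.
pose P g := forall x, M x -> exists2 y, M y & L0 ((rho y)^-1 * (g * rho x)).
have PM g h : P g -> P h -> P (g * h).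
  move=> Pg Ph x /Ph[y My L0y]; have [z Mz L0z] := Pg y My; exists z => //.
  by have := subgroupM sgL0 L0z L0y; rewrite -!mulgA mulVKg.
have Ps a : a \in s ++ [seq a^-1 | a <- s] -> P a.
  move=> sa x Mx; exists (a * rho x).
    by apply: subgroupM => //; [exact: Ms'|exact: rhoM].
  apply: sub_generated; apply/allpairsP; exists (a, rho x); split=> //=.
  by rewrite mem_filter rho_mem andbT; apply/asboolP; exact: rhoM.
have PP : generated [set` s] `<=` [set g | P g /\ P g^-1].
  apply: generated_min; last first.
    move=> a /= sa; split; apply: Ps; rewrite mem_cat ?sa ?orbT //.
    by rewrite map_f ?orbT.
  split=> [|x y [Px Px'] [Py Py']|x [Px Px']]; last by rewrite /= invgK.
    by rewrite /= invg1; split=> x Mx; exists x => //;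
      rewrite mul1g mulVg; exact: subgroup1.
  by rewrite /= invgM; split; exact: PM.
move=> h Lh; have [Ph _] : [set g | P g /\ P g^-1] h.
  by apply: PP; rewrite -defM; exact: sLM.
have [y My] := Ph 1 (subgroup1 sgM).
rewrite (rhoL 1 (subgroup1 sgL)) mulg1 => L0y.
suff Ly : L y by move: L0y; rewrite rhoL // invg1 mul1g.
have Lry : L (rho y).
  rewrite -[rho y]invgK; apply: subgroupV => //.
  by apply: (subgroupMr sgL Lh); exact: sL0.
by have := subgroupM sgL Lry (rhoP y My); rewrite mulVKg.
Qed.

Section HomOn.
Variables (R : groupType) (M : set G) (chi : G -> R).
Hypotheses (sgM : is_subgroup M) (chiM : hom_on M chi).

Lemma hom_on1 : chi 1 = 1.
Proof.
have M1 := subgroup1 sgM.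
by apply: (mulgI (chi 1)); rewrite -chiM // !mulg1.
Qed.

Lemma hom_onV x : M x -> chi x^-1 = (chi x)^-1.
Proof.
move=> Mx; apply: (mulgI (chi x)); rewrite -chiM ?mulgV ?hom_on1 //.
exact: subgroupV.
Qed.

End HomOn.

Lemma hom_on_eq (R : groupType) M s (chi chi' : G -> R) :
  M = generated [set` s] -> hom_on M chi -> hom_on M chi' ->
  {in s, chi =1 chi'} -> forall x, M x -> chi x = chi' x.
Proof.
move=> defM cM cM' eqs; have sgM : is_subgroup M.
  by rewrite defM; exact: generated_subgroup.
suff eqM : generated [set` s] `<=` [set x | M x /\ chi x = chi' x].
  by move=> x; rewrite {1}defM => /eqM[].
apply: generated_min => [|a /= sa]; last first.
  by split; [rewrite defM; exact: sub_generated|exact: eqs].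
split=> [|x y [Mx ex] [My ey]|x [Mx ex]].
- by split; [exact: subgroup1|rewrite !(hom_on1 sgM)].
- by split; [exact: subgroupM|rewrite cM // cM' // ex ey].
- by split; [exact: subgroupV|rewrite !(hom_onV sgM) // ex].
Qed.

(** The values on the generators determine a homomorphism, so that there are
    finitely many. *)
Lemma hom_pigeonhole (R : finGroupType) M : fingen M -> exists c,
  forall chi : nat -> G -> R, (forall i, hom_on M (chi i)) ->
  exists i j, [/\ (i < j)%N, (j <= c)%N & forall x, M x -> chi i x = chi j x].
Proof.
move=> [s defM]; exists #|{: (size s).-tuple R}| => chi chiM.
have [i [j [ltij lejc eqv]]] := pigeonhole (fun i => map_tuple (chi i) (in_tuple s)).
exists i, j; split=> //; apply: hom_on_eq defM _ _ _ => //.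
by move/(congr1 val): eqv => /= /eq_in_map.
Qed.

(** Involving no choice, it is preserved by the endomorphisms of [M]; for
    finite [R] and finitely generated [M] it has finite index. *)
Definition hom_core (R : groupType) M : set G :=
  [set x | M x /\ forall chi : G -> R, hom_on M chi -> chi x = 1].

Lemma hom_core_subgroup (R : groupType) M :
  is_subgroup M -> is_subgroup (hom_core R M).
Proof.
move=> sgM; split=> [|x y [Mx xP] [My yP]|x [Mx xP]].
- by split=> [|c hc]; [exact: subgroup1|exact: hom_on1 hc].
- split=> [|c hc]; first exact: subgroupM.
  by rewrite hc // xP // yP // mulg1.
- split=> [|c hc]; first exact: subgroupV.
  by rewrite (hom_onV sgM hc) // xP // invg1.
Qed.

Lemma hom_core_sub (R : groupType) M : hom_core R M `<=` M.
Proof. by move=> x []. Qed.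

Lemma hom_core_stable (R : groupType) M (f : G -> G) :
  hom_on M f -> (forall x, M x -> M (f x)) ->
  forall x, hom_core R M x -> hom_core R M (f x).
Proof.
move=> fM Mf x [Mx xP]; split=> [|chi chiM]; first exact: Mf.
by apply: (xP (chi \o f)) => y z My Mz /=; rewrite fM // chiM //; exact: Mf.
Qed.

Lemma hom_core_fin_index (R : finGroupType) M :
  fingen M -> fin_index M (hom_core R M).
Proof.
move=> [s defM]; have sgM : is_subgroup M by rewrite defM; exact: generated_subgroup.
pose chi (v : (size s).-tuple R) : G -> R :=
  xget (fun=> 1) [set c | hom_on M c /\ map c s = v].
have chiM v : hom_on M (chi v).
  rewrite /chi; case: xgetP => [c _ [] //|_ x y _ _]; exact/esym/mulg1.
exists {ffun (size s).-tuple R -> R}, (fun x => [ffun v => chi v x]).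
move=> x y Mx My /ffunP eqxy; split; first exact: subgroupVl.
move=> c hc; have [_ eqc] : hom_on M (chi (map_tuple c (in_tuple s))) /\
    map (chi (map_tuple c (in_tuple s))) s = map_tuple c (in_tuple s).
  by rewrite /chi; apply: (@xgetI _ _ [set c0 | hom_on M c0 /\ map c0 s = _] c).
have eqv z : M z -> c z = chi (map_tuple c (in_tuple s)) z.
  move=> Mz; apply: (hom_on_eq defM hc (chiM _)) => // a sa.
  by move/eq_in_map: eqc => /(_ a sa) ->.
apply: (mulgI (c x)); rewrite -hc ?mulVKg ?mulg1 //; last exact: subgroupVl.
by have := eqxy (map_tuple c (in_tuple s)); rewrite !ffunE -!eqv // => ->.
Qed.

End Generation.

(** * Periodic points of endomorphisms *)

Section Frobenius.
Variables (G : groupType) (K : finFieldType) (p : nat).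
Hypothesis chK : p \in [pchar K]%R.
Variable H : set G.
Hypothesis sgH : is_subgroup H.
Implicit Types (F : G -> K) (d : nat).

(** If [theta] is additive up to functions of degree less than [e], then the
    [e]-fold differences of [theta a] at a point are homomorphisms in [a], and
    those vanish on the core. *)
Lemma degree_lt_quasi_hom e (theta : G -> G -> K) l : hom_core K H l ->
  (forall a b, H a -> H b ->
    degree_lt H e (fun x => theta (a * b)%g x - theta a x - theta b x)%R) ->
  degree_lt H e (theta l).
Proof.
case=> Hl coreH; elim: e theta => [|e IHe] theta thetaM.
  move=> x Hx; apply: (coreH (theta^~ x)) => a b Ha Hb.
  have /eqP := thetaM a b Ha Hb x Hx.
  by rewrite -addrA -opprD subr_eq0 => /eqP.
move=> h Hh; apply: (IHe (fun a => diff h (theta a))) => a b Ha Hb.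
apply: degree_lt_ext (thetaM a b Ha Hb h Hh) => x.
by rewrite /diff; ring.
Qed.

Lemma degree_lt_core d l F :
  hom_core K H l -> degree_lt H d F -> degree_lt H d.-2 (diff l F).
Proof.
move=> corel dF; have [Hl _] := corel; case: d dF => [|[|d]] dF.
- exact: degree_lt_diff.
- exact: dF.
apply: (degree_lt_quasi_hom (theta := fun a => diff a F)) corel _ => a b Ha Hb.
apply: degree_lt_ext (dF b Hb a Ha) => x.
by rewrite /diff mulgA; ring.
Qed.

Variable psi : G -> G.
Hypotheses (psiM : hom_on H psi) (psiH : forall x, H x -> H (psi x)).
Hypothesis psi_idem : forall chi : G -> K, hom_on H chi ->
  forall x, H x -> chi (psi (psi x)) = chi (psi x).

(** The increment of [F \o psi \o psi - F \o psi] in the direction [h] is the sum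
    of the same expression for the increment of [F] along [psi (psi h)], which is
    handled by induction, and of the increment of [F] along
    [l = (psi h)^-1 * psi (psi h)]; as [psi] is idempotent on homomorphisms, [l]
    is in the core, and this increment loses two degrees at once. *)
Lemma degree_lt_drop d F : degree_lt H d F ->
  degree_lt H d.-1 (fun x => F (psi (psi x)) - F (psi x))%R.
Proof.
elim: d F => [|d IHd] F dF; first by move=> x /psiH Hx; rewrite !dF ?subrr //;
  exact: psiH.
case: d IHd dF => [|d] IHd dF.
  move=> x Hx; have Hpx := psiH Hx; have Hppx := psiH Hpx.
  have := dF _ (subgroupVl sgH Hpx Hppx) _ Hpx.
  by rewrite /diff mulVKg.
move=> h Hh; have Hph := psiH Hh; have Hpph := psiH Hph.
set l := (psi h)^-1 * psi (psi h).
have Hl : H l by exact: subgroupVl.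
have corel : hom_core K H l.
  split=> // chi chiM; apply: (mulgI (chi (psi h))).
  by rewrite -chiM // mulVKg mulg1 psi_idem.
have drop := IHd _ (dF _ Hpph).
have := degree_lt_shiftr sgH Hph (degree_lt_core corel dF).
move/(degree_lt_comp sgH psiM psiH)/(degree_ltD drop).
apply: eq_degree_lt => // x Hx; have Hpx := psiH Hx.
rewrite /diff /= -!mulgA mulVKg !psiM //; ring.
Qed.

Lemma iter_stable n x : H x -> H (iter n psi x).
Proof. by elim: n => //= n IHn /IHn; exact: psiH. Qed.

(** By induction on the degree, the increments of [F] along the orbit have
    period [p ^ d]; so [F] grows by a constant over each such stretch, and [p]
    stretches bring it back. Periodicity of [x] makes every point of the orbit
    a value of [psi], as [degree_lt_drop] demands. *)
Lemma degree_lt_orbit d F x n : degree_lt H d F -> H x -> (0 < n)%N ->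
  iter n psi x = x -> forall j, F (iter (j + p ^ d) psi x) = F (iter j psi x).
Proof.
move=> + Hx n_gt0 xn; elim: d F => [|d IHd] F dF j.
  by rewrite !dF //; exact: iter_stable.
have xn' i : iter (i + n) psi x = iter i psi x by rewrite iterD xn.
suff step i : F (iter (i.+1 + p ^ d.+1) psi x) = F (iter i.+1 psi x).
  rewrite -(xn' j) -(xn' (j + _)%N) addnAC.
  by move: n_gt0; case: (n) => // m _; rewrite addnS; exact: step.
have {}IHd := IHd _ (degree_lt_drop dF).
have incr k : (F (iter (k.+1 + p ^ d) psi x) - F (iter k.+1 psi x)
             = F (iter (1 + p ^ d) psi x) - F (iter 1 psi x))%R.
  elim: k => // k <-; have := IHd k; rewrite !addSn /= => E.
  have -> : F (psi (psi (iter (k + p ^ d) psi x))) =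
    (F (psi (iter (k + p ^ d) psi x)) + (F (psi (psi (iter k psi x)))
      - F (psi (iter k psi x))))%R.
    by rewrite -E addrC subrK.
  by ring.
set c := (_ - _)%R in incr.
have mult m : (F (iter (i.+1 + m * p ^ d) psi x) = F (iter i.+1 psi x) + c *+ m)%R.
  elim: m => [|m IHm]; first by rewrite mul0n addn0 mulr0n addr0.
  rewrite mulSn addnA mulrS addrCA -IHm.
  have := incr (i + m * p ^ d)%N => <-.
  by rewrite -addSn addnAC subrK.
by rewrite expnS mult -mulr_natr (pcharf0 chK) mulr0 addr0.
Qed.

(** By Euler's theorem [p ^ e] is congruent to the [p]-part of [m] modulo [m] for
    arbitrarily large [e], so that no polynomial function tells the two values
    of [z] apart. *)
Lemma separated_prime_part (z : nat -> G) m : separated K H ->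
  (forall j, H (z j)) -> (0 < m)%N -> (forall j, z (j + m)%N = z j) ->
  (forall d F, degree_lt H d F -> F (z (p ^ d)%N) = F (z 0%N)) -> z (m`_p)%N = z 0%N.
Proof.
move=> sepH zH m_gt0 zm zF; apply/eqP/negP => /negP zne.
set x := (z 0%N)^-1 * z (m`_p)%N.
have Hx : H x by exact: subgroupVl.
have x1 : x <> 1.
  by move=> x1; case/eqP: zne; rewrite -[RHS]mulg1 -x1 mulVKg.
have [d [F [dF Fx]]] := sepH x Hx x1.
apply: Fx; rewrite -(mulVg (z 0%N)).
have pr_p := pcharf_prime chK.
set a := logn p m; set m' := (m %/ p ^ a)%N.
have defm : m = (p ^ a * m')%N by rewrite mulnC divnK // pfactor_dvdnn.
have co : coprime p m'.
  have m'_gt0 : (0 < m')%N by move: m_gt0; rewrite defm muln_gt0 => /andP[].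
  rewrite prime_coprime //; apply/negP => pm'.
  have := pfactor_dvdn a.+1 pr_p m_gt0; rewrite ltnn expnSr {1}defm.
  by rewrite dvdn_pmul2l ?expn_gt0 ?prime_gt0 // pm'.
pose e := (a + totient m' * d)%N.
have led : (d <= e)%N.
  apply: leq_trans (leq_addl _ _); apply: leq_pmull.
  by rewrite totient_gt0; move: m_gt0; rewrite defm muln_gt0 => /andP[].
have [k defe] : exists k, (p ^ e = p ^ a + k * m)%N.
  have : p ^ (totient m' * d) = 1 %[mod m'].
    by rewrite expnM -modnXm Euler_exp_totient // modnXm exp1n.
  move/eqP; rewrite eqn_mod_dvd ?expn_gt0 ?prime_gt0 // => /dvdnP[k defk].
  exists k; rewrite expnD -(subnK (_ : 1 <= p ^ (totient m' * d))%N); last first.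
    by rewrite expn_gt0 prime_gt0.
  by rewrite defk addn1 mulnS [in RHS]defm mulnCA.
have zk j i : z (j + i * m)%N = z j.
  by elim: i => [|i IHi]; rewrite ?mul0n ?addn0 // mulSn addnCA addnC zm.
have := zF e (fun y => F ((z 0%N)^-1 * y)).
rewrite defe zk /x p_part; apply.
by apply: degree_lt_shiftl; [| exact: subgroupV | exact: degree_lt_leq dF].
Qed.

End Frobenius.

Section Endgame.
Variables (G : groupType) (p q : nat) (K L : finFieldType).
Hypotheses (chK : p \in [pchar K]%R) (chL : q \in [pchar L]%R) (pq : p != q).

Lemma separated_torsion (k : nat) (M : finFieldType) (H : set G) x n :
    k \in [pchar M]%R -> is_subgroup H -> separated M H ->
  H x -> (0 < n)%N -> x ^+ n = 1 -> x ^+ (n`_k)%N = 1.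
Proof.
move=> chM sgH sepH Hx n_gt0 xn.
apply: (separated_prime_part chM sgH (z := fun j => x ^+ j) sepH) => //.
- by move=> j; exact: subgroupX.
- by move=> j; rewrite expgnDr xn mulg1.
move=> d; suff step (F : G -> M) : degree_lt H d F -> forall y, H y ->
  F (y * x ^+ (k ^ d)%N) = F y.
  by move=> F dF; have := step F dF 1 (subgroup1 sgH); rewrite mul1g.
elim: d F => [|d IHd] F dF y Hy.
  by rewrite !dF //; apply: subgroupM => //; exact: subgroupX.
have Hj j : H (y * x ^+ j) by apply: subgroupM => //; exact: subgroupX.
have incr j : (F (y * x ^+ (j + k ^ d)%N)%g - F (y * x ^+ j)%g
              = F (y * x ^+ (k ^ d)%N)%g - F y)%R.
  elim: j => [|j <-]; first by rewrite mulg1.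
  have := IHd _ (dF x Hx) _ (Hj j).
  rewrite /diff -!mulgA -!expgSr -!expgnDr addnS addSn.
  by move/eqP; rewrite subr_eq => /eqP ->; ring.
have mult m : (F (y * x ^+ (m * k ^ d)%N)%g = F y + (F (y * x ^+ (k ^ d)%N)%g - F y)
  *+ m)%R.
  elim: m => [|m IHm]; first by rewrite mul0n mulr0n addr0 mulg1.
  by rewrite mulSn addnC mulrS addrCA -IHm -(incr (m * k ^ d)%N) subrK.
by rewrite expnS mult -mulr_natr (pcharf0 chM) mulr0 addr0.
Qed.

Lemma gcd_prime_parts a b n :
  (0 < a)%N -> (0 < b)%N -> (0 < n)%N -> (gcdn (a * n`_p) (b * n`_q) %| a * b)%N.
Proof.
move=> a_gt0 b_gt0 n_gt0; have co : coprime n`_p n`_q.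
  rewrite !p_part; apply/coprimeXl/coprimeXr.
  by rewrite prime_coprime ?(pcharf_prime chK) // dvdn_prime2
    ?(pcharf_prime chK) ?(pcharf_prime chL).
have -> : (a * b = gcdn (a * b * n`_p) (a * b * n`_q))%N.
  by rewrite -muln_gcdr (eqP co) muln1.
rewrite dvdn_gcd; apply/andP; split.
  by apply: dvdn_trans (dvdn_gcdl _ _) _; rewrite mulnAC dvdn_mulr.
by apply: dvdn_trans (dvdn_gcdr _ _) _; rewrite -mulnA dvdn_mull.
Qed.

Lemma separated_torsion_free (H : set G) x n : is_subgroup H ->
    separated K H -> separated L H -> H x -> (0 < n)%N -> x ^+ n = 1 -> x = 1.
Proof.
move=> sgH sepK sepL Hx n_gt0 xn.
have xp := separated_torsion chK sgH sepK Hx n_gt0 xn.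
have xq := separated_torsion chL sgH sepL Hx n_gt0 xn.
have := gcd_prime_parts (ltn0Sn 0) (ltn0Sn 0) n_gt0; rewrite !mul1n dvdn1 => /eqP co.
case: (egcdnP n`_q (part_gt0 p n)) => u v; rewrite co => E _.
have : x ^+ (u * n`_p)%N = x by rewrite E addn1 expgS mulnC expgnA xq expg1n mulg1.
by rewrite mulnC expgnA xp expg1n => <-.
Qed.

Lemma iter_gcd (f : G -> G) x a b :
  (0 < a)%N -> iter a f x = x -> iter b f x = x -> iter (gcdn a b) f x = x.
Proof.
move=> a_gt0 xa xb; case: (egcdnP b a_gt0) => u v E _.
have ua : iter (u * a) f x = x by rewrite iterM iter_fix.
have vb : iter (v * b) f x = x by rewrite iterM iter_fix.
by rewrite -{2}ua E addnC iterD vb.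
Qed.

(** The homomorphisms [chi \o iter i f] are eventually periodic in [i], with
    preperiod and period bounded by [c]; [c.+1`!] is a multiple of every such
    period and exceeds the preperiod. *)
Lemma hom_iter_stable (R : finGroupType) (M : set G) (f : G -> G) :
  fingen M -> hom_on M f -> (forall x, M x -> M (f x)) ->
  exists2 N, (0 < N)%N & forall chi : G -> R, hom_on M chi ->
    forall x, M x -> chi (iter N f (iter N f x)) = chi (iter N f x).
Proof.
move=> fgM fM Mf; have [c cP] := hom_pigeonhole R fgM.
exists c.+1`!; first exact: fact_gt0.
move=> chi chiM; have Mi k x : M x -> M (iter k f x) by elim: k => //= k IHk /IHk;
  exact: Mf.
have [|i [j [ltij lejc eqij]]] := cP (fun k => chi \o iter k f).
  move=> k x y Mx My /=; suff -> : iter k f (x * y) = iter k f x * iter k f y.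
    by rewrite chiM //; exact: Mi.
  by elim: k => //= k ->; rewrite fM //; exact: Mi.
have step k x : (i <= k)%N -> M x -> chi (iter (k + (j - i)) f x) = chi (iter k f x).
  move=> /subnK <- Mx; rewrite -addnA subnKC ?(ltnW ltij) //.
  by rewrite addnC [in RHS]addnC !iterD; apply/esym/eqij/Mi.
have steps t k x : (i <= k)%N -> M x ->
    chi (iter (k + t * (j - i)) f x) = chi (iter k f x).
  move=> ik Mx; elim: t => [|t IHt]; first by rewrite addn0.
  by rewrite mulSnr addnA step // (leq_trans ik) // leq_addr.
have /dvdnP[t defN] : (j - i %| c.+1`!)%N.
  by rewrite dvdn_fact // subn_gt0 ltij (leq_trans (leq_subr _ _)) // ltnW.
move=> x Mx; rewrite -iterD {2}defN steps //.
by rewrite (leq_trans (ltnW ltij)) // (leq_trans lejc) // ltnW // fact_geq.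
Qed.

Lemma separated_period (k : nat) (M : finFieldType) (H : set G) (f : G -> G) :
    k \in [pchar M]%R -> fingen H -> separated M H ->
    hom_on H f -> (forall x, H x -> H (f x)) ->
  exists2 N, (0 < N)%N & forall x n, H x -> (0 < n)%N -> iter n f x = x ->
    iter (N * n`_k) f x = x.
Proof.
move=> chM fgH sepH fM Hf; have sgH := fingen_subgroup fgH.
have [N N_gt0 NP] := hom_iter_stable M fgH fM Hf.
exists N => // x n Hx n_gt0 xn; rewrite mulnC iterM.
have Hi j y : H y -> H (iter j f y) by elim: j => //= j IHj /IHj; exact: Hf.
have NM : hom_on H (iter N f).
  by move=> y z Hy Hz; elim: (N) => //= j ->; rewrite fM //; exact: Hi.
have xn' : iter n (iter N f) x = x by rewrite -iterM mulnC iterM iter_fix.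
apply: (separated_prime_part chM sgH (z := fun j => iter j (iter N f) x) sepH) => //.
- by move=> j; apply: iter_stable => //; exact: Hi.
- by move=> j; rewrite iterD xn'.
move=> d F dF.
exact: (degree_lt_orbit chM sgH NM (Hi N) NP dF Hx n_gt0 xn' 0).
Qed.

(** Elements of [H] fixed by a power of [phi] are fixed by [phi ^ M], whatever
    their period. A periodic point [x] returns to its coset of [H] after a
    bounded time: [phi ^ r (x) = x y] with [y] in [H] fixed by [phi ^ r], so
    that [phi ^ (r k) (x) = x y ^ k], and [y = 1] since [H] is torsion-free. *)
Theorem bounded_periods (H : set G) (phi : G -> G) :
    fingen [set: G] -> is_subgroup H -> fin_index [set: G] H ->
    {morph phi : x y / x * y} -> (forall x, H x -> H (phi x)) ->
    separated K H -> separated L H ->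
  exists2 R, (0 < R)%N & forall x n, (0 < n)%N -> iter n phi x = x -> iter R phi x = x.
Proof.
move=> fgG sgH finH phiM Hphi sepK sepL.
have fgH := fingen_fin_index fgG sgH (@subsetT _ H) finH.
have [T [f fP]] := finH.
have phiH : hom_on H phi by move=> x y _ _; exact: phiM.
have [N N_gt0 NP] := separated_period chK fgH sepK phiH Hphi.
have [N' N'_gt0 N'P] := separated_period chL fgH sepL phiH Hphi.
pose M := (N * N')%N.
have fixH x n : H x -> (0 < n)%N -> iter n phi x = x -> iter M phi x = x.
  move=> Hx n_gt0 xn; have /dvdnP[t defM] := gcd_prime_parts N_gt0 N'_gt0 n_gt0.
  rewrite /M defM iterM iter_fix // iter_gcd ?muln_gt0 ?N_gt0 ?part_gt0 //.
    exact: NP xn.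
  exact: N'P xn.
have iterphiM k : {morph iter k phi : x y / x * y}.
  by move=> x y; elim: k => //= k ->; exact: phiM.
have phi1 : phi 1 = 1 by apply: (mulgI (phi 1)); rewrite -phiM !mulg1.
have iterphiV k x : iter k phi x^-1 = (iter k phi x)^-1.
  apply: (mulgI (iter k phi x)); rewrite -iterphiM !mulgV.
  by elim: k => //= k ->.
have Hi k x : H x -> H (iter k phi x) by elim: k => //= k IHk /IHk; exact: Hphi.
pose c := #|T|; exists (c`! * M)%N; first by rewrite !muln_gt0 fact_gt0 N_gt0.
move=> x n n_gt0 xn.
have [r r_gt0 [lerc Hr]] : exists2 r, (0 < r)%N & (r <= c)%N /\ H (x^-1 * iter r phi x).
  have [i [j [ltij lejc eqv]]] := pigeonhole (fun i => f (iter i phi x)).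
  exists (j - i)%N; first by rewrite subn_gt0.
  split; first by rewrite (leq_trans (leq_subr _ _)).
  have Hij := fP _ _ I I eqv; have := Hi (i * n - i)%N _ Hij.
  rewrite iterphiM iterphiV -!iterD subnK ?leq_pmulr //.
  rewrite addnBAC ?leq_pmulr // addnC -addnBAC ?(ltnW ltij) // iterD.
  by rewrite iterM iter_fix.
have Hmul t : H (x^-1 * iter (t * r) phi x).
  elim: t => [|t IHt]; first by rewrite mul0n mulVg; exact: subgroup1.
  rewrite mulSn iterD; have := subgroupM sgH Hr (Hi r _ IHt).
  by rewrite iterphiM iterphiV -mulgA mulVKg.
have /dvdnP[t deft] : (r %| c`!)%N by rewrite dvdn_fact // r_gt0.
set y := x^-1 * iter (c`! * M) phi x.
have Hy : H y by rewrite /y deft mulnAC; exact: Hmul.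
have yn : iter n phi y = y.
  by rewrite iterphiM iterphiV -iterD addnC iterD xn.
have yM : iter (c`! * M) phi y = y by rewrite iterM iter_fix // (fixH _ _ Hy n_gt0 yn).
have xpow k : iter (k * (c`! * M)) phi x = x * y ^+ k.
  elim: k => [|k IHk]; first by rewrite expg0 mulg1.
  rewrite mulSn addnC iterD -[iter (c`! * M) phi x](mulVKg x) -/y iterphiM IHk.
  by rewrite iterM iter_fix // -mulgA -expgSr.
have : y = 1.
  apply: (separated_torsion_free sgH sepK sepL Hy n_gt0).
  by apply: (mulgI x); rewrite -xpow mulg1 mulnC iterM iter_fix.
by move/(congr1 (mulg x)); rewrite mulVKg mulg1.
Qed.

End Endgame.

(** * Integer powers *)

Section IntPower.
Variable G : groupType.
Implicit Types (t x : G) (i j : int).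

Definition zpow t i : G :=
  match i with Posz n => t ^+ n | Negz n => (t ^+ n.+1)^-1 end.

Lemma zpow1 t : zpow t 1%R = t. Proof. exact: expg1. Qed.

Lemma zpowS t i : zpow t (i + 1)%R = zpow t i * t.
Proof.
case: i => n /=; first by rewrite addn1 expgSr.
rewrite NegzE -addn1 PoszD opprD addrNK; case: n => [|n] /=.
  by rewrite expg1 mulVg.
by rewrite addn1 [in RHS]expgS invgM mulgVK.
Qed.

Lemma zpowB1 t i : zpow t (i - 1)%R = zpow t i * t^-1.
Proof. by apply: (mulIg t); rewrite -zpowS subrK mulgVK. Qed.

Lemma zpowD t i j : zpow t (i + j)%R = zpow t i * zpow t j.
Proof.
elim/int_rect: j => [|n IHn|n IHn]; first by rewrite addr0 mulg1.
  by rewrite -addn1 PoszD addrA !zpowS IHn mulgA.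
by rewrite -addn1 PoszD opprD addrA !zpowB1 IHn mulgA.
Qed.

Lemma zpowN t i : zpow t (- i)%R = (zpow t i)^-1.
Proof. by apply: (mulgI (zpow t i)); rewrite -zpowD subrr mulgV. Qed.

Lemma zpowM t i n : zpow t (i * n%:Z)%R = zpow (t ^+ n) i.
Proof.
elim/int_rect: i => [|k IHk|k IHk]; first by rewrite mul0r.
- by rewrite -addn1 PoszD zpowS -IHk mulrDl mul1r [LHS]zpowD.
- by rewrite -addn1 PoszD opprD zpowB1 -IHk mulrDl mulN1r [LHS]zpowD zpowN.
Qed.

End IntPower.

(** * Actions on finitely many cosets *)

(** [M] acts on the right cosets of [L]. The coset of [x] is encoded by the set
    of labels of the inverses of its elements. *)
Lemma fin_index_hom (G : groupType) (M L : set G) : is_subgroup M ->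
    is_subgroup L -> L `<=` M -> fin_index M L -> exists (T : finType)
  (pi : G -> {perm T}), hom_on M pi /\ forall x, M x -> pi x = 1 -> L x.
Proof.
move=> sgM sgL sLM [T [f fP]].
pose C x := finset (fun t => `[< exists2 y, M y & L (x * y^-1) /\ f y^-1 = t >]).
have CP x y : M x -> M y -> C x = C y <-> L (x * y^-1).
  move=> Mx My; split=> [eqC|Lxy].
    have : f x^-1 \in C y.
      rewrite -eqC inE; apply/asboolP; exists x => //.
      by split=> //; rewrite mulgV; exact: subgroup1.
    rewrite inE => /asboolP[z Mz [Lyz]] /(fP _ _ (subgroupV sgM Mz) (subgroupV sgM Mx)).
    rewrite invgK => /(subgroupM sgL Lyz)/(subgroupV sgL).
    by rewrite mulgA mulgVK invgM invgK.
  apply/setP => t; rewrite !inE; apply/asboolP/asboolP => -[z Mz [Lz ft]];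
      exists z => //; split=> //.
    by have := subgroupVl sgL Lxy Lz; rewrite invgM invgK mulgA mulgVK.
  by have := subgroupM sgL Lxy Lz; rewrite mulgA mulgVK.
pose lift a := xget 1 [set x | M x /\ C x = a].
have liftP x : M x -> M (lift (C x)) /\ C (lift (C x)) = C x.
  by move=> Mx; apply: (@xgetI _ 1 [set y | M y /\ C y = C x] x).
pose act g a := if `[< exists2 x, M x & C x = a >] then C (lift a * g) else a.
have actC g x : M g -> M x -> act g (C x) = C (x * g).
  move=> Mg Mx; rewrite /act; case: asboolP => [_|]; last by case; exists x.
  have [Ml Cl] := liftP x Mx; apply/CP; try exact: subgroupM.
  by rewrite invgM mulgA mulgK; apply/CP.
have actM g h a : M g -> M h -> act (g * h) a = act h (act g a).
  move=> Mg Mh; have [[x Mx <-]|na] := pselect (exists2 x, M x & C x = a).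
    by rewrite !actC ?mulgA //; exact: subgroupM.
  rewrite {1 3}/act; case: asboolP => // _.
  by rewrite /act; case: asboolP.
have act1 a : act 1 a = a.
  rewrite /act; case: asboolP => // -[x Mx <-]; rewrite mulg1.
  by case: (liftP x Mx).
have actI g : M g -> injective (act g).
  move=> Mg; apply: (can_inj (g := act g^-1)) => a.
  by rewrite -actM ?mulgV //; exact: subgroupV.
pose pi g : {perm {set T}} := xget 1 [set s : {perm {set T}} | s =1 act g].
have piE g : M g -> pi g =1 act g.
  move=> Mg; apply: (@xgetI _ 1 [set s : {perm {set T}} | s =1 act g] (perm (actI g
    Mg))).
  by move=> a; rewrite permE.
exists {set T}, pi; split=> [x y Mx My|x Mx pix].
  by apply/permP => a; rewrite permM !piE ?actM //; exact: subgroupM.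
have := piE x Mx (C 1); rewrite pix perm1 actC //; last exact: subgroup1.
rewrite mul1g => /esym/CP; rewrite invg1 mulg1; apply=> //; exact: subgroup1.
Qed.

(** * Polynomial functions on cyclic extensions *)

Definition normalizes (G : groupType) (t : G) (M : set G) : Prop :=
  forall x, M x <-> M (x ^ t).

Definition cyclic_ext (G : groupType) (t : G) (M : set G) : set G :=
  [set x | exists i m, M m /\ x = zpow t i * m].

Section CyclicExt.
Variables (G : groupType) (t : G) (M : set G).
Hypotheses (sgM : is_subgroup M) (nMt : normalizes t M).

Lemma normalizes_zpow i : normalizes (zpow t i) M.
Proof.
elim/int_rect: i => [|n IHn|n IHn] x; first by rewrite conjg1.
  by rewrite -addn1 PoszD zpowS conjgM -nMt; exact: IHn.
by rewrite -addn1 PoszD opprD zpowB1 conjgM [M (_ ^ t^-1)]nMt conjgKV; exact: IHn.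
Qed.

Lemma conj_zpow i x : M x -> M (x ^ zpow t i).
Proof. by move/(normalizes_zpow i). Qed.

Lemma normalizes_exp n : normalizes (t ^+ n) M.
Proof. exact: (normalizes_zpow n). Qed.

Lemma cyclic_extM i j m n :
  zpow t i * m * (zpow t j * n) = zpow t (i + j)%R * (m ^ zpow t j * n).
Proof. by rewrite zpowD /conjg -!mulgA mulVKg. Qed.

Lemma cyclic_extV i m : (zpow t i * m)^-1 = zpow t (- i)%R * (m^-1) ^ zpow t (- i)%R.
Proof. by rewrite invgM -zpowN /conjg mulVKg. Qed.

Lemma cyclic_ext_subgroup : is_subgroup (cyclic_ext t M).
Proof.
split=> [|x y [i [m [Mm ->]]] [j [n [Mn ->]]]|x [i [m [Mm ->]]]].
- by exists 0%R, 1; split; [exact: subgroup1|rewrite mulg1].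
- exists (i + j)%R, (m ^ zpow t j * n); split; last exact: cyclic_extM.
  by apply: subgroupM => //; exact: conj_zpow.
- exists (- i)%R, ((m^-1) ^ zpow t (- i)%R); split; last exact: cyclic_extV.
  by apply: conj_zpow; exact: subgroupV.
Qed.

Lemma sub_cyclic_ext : M `<=` cyclic_ext t M.
Proof. by move=> m Mm; exists 0%R, m; rewrite mul1g. Qed.

Lemma cyclic_ext_gen : cyclic_ext t M t.
Proof. by exists 1%R, 1; rewrite mulg1 zpow1; split=> //; exact: subgroup1. Qed.

Lemma cyclic_ext_min L : is_subgroup L -> L t -> M `<=` L -> cyclic_ext t M `<=` L.
Proof.
move=> sgL Lt sML x [i [m [/sML Lm ->]]]; apply: subgroupM => //.
by case: i => n /=; [|apply: subgroupV => //]; exact: subgroupX.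
Qed.

Lemma cyclic_ext_fingen : fingen M -> fingen (cyclic_ext t M).
Proof.
case=> s defM; exists (t :: s); apply/seteqP; split; last first.
  apply: generated_min => [|a /=]; first exact: cyclic_ext_subgroup.
  rewrite inE => /orP[/eqP->|sa]; first exact: cyclic_ext_gen.
  by apply: sub_cyclic_ext; rewrite defM; exact: sub_generated.
apply: cyclic_ext_min; first exact: generated_subgroup.
  by apply: sub_generated; rewrite /= mem_head.
rewrite defM; apply: generated_min; first exact: generated_subgroup.
by move=> a /= sa; apply: sub_generated; rewrite /= inE sa orbT.
Qed.

Variables (K : finFieldType) (p : nat).
Hypothesis chK : p \in [pchar K]%R.
Hypothesis fixK : forall chi : G -> K, hom_on M chi ->
  forall x, M x -> chi (x ^ t) = chi x.

Lemma fixK_zpow i (chi : G -> K) : hom_on M chi ->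
  forall x, M x -> chi (x ^ zpow t i) = chi x.
Proof.
move=> chiM; elim/int_rect: i => [|n IHn|n IHn] x Mx; first by rewrite conjg1.
  rewrite -addn1 PoszD zpowS conjgM fixK //; first exact: IHn.
  exact: conj_zpow.
rewrite -addn1 PoszD opprD zpowB1 conjgM -fixK // ?conjgKV; first exact: IHn.
by rewrite nMt conjgKV; exact: conj_zpow.
Qed.

Lemma degree_lt_conj d i (F : G -> K) : degree_lt M d.+1 F ->
  degree_lt M d (fun x => F (x ^ zpow t i)%g - F x)%R.
Proof.
move=> dF; pose sg x := x ^ zpow t i.
have conjM j : hom_on M (conjg^~ (zpow t j)) by move=> x y _ _; exact: conjMg.
have conj_stable j x : M x -> M (x ^ zpow t j) by exact: conj_zpow.
have dF' : degree_lt M d.+1 (F \o conjg^~ (zpow t (- i)%R)).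
  exact: degree_lt_comp (conjM _) (conj_stable _) dF.
have := degree_lt_drop sgM (conjM i) (conj_stable i) _ dF'.
rewrite zpowN; under eq_fun do rewrite /= !conjgK.
by apply=> chi chiM x Mx; rewrite fixK_zpow //; exact: conj_stable.
Qed.

Hypothesis inf_t : forall i, M (zpow t i) -> i = 0%R.

Definition ext_exp x : int := xget 0%R [set i | M (zpow t (- i)%R * x)].

Lemma ext_expE i m : M m -> ext_exp (zpow t i * m) = i.
Proof.
move=> Mm; rewrite /ext_exp; case: xgetP => [j _ /= Mj|/(_ i)]; last first.
  by case; rewrite /= zpowN mulKg.
apply/eqP; rewrite -subr_eq0 -oppr_eq0 opprB addrC; apply/eqP; apply: inf_t.
by rewrite zpowD; apply: (subgroupMr sgM Mm); rewrite -mulgA.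
Qed.

Definition ext_part x : G := zpow t (- ext_exp x)%R * x.

Lemma ext_partE i m : M m -> ext_part (zpow t i * m) = m.
Proof. by move=> Mm; rewrite /ext_part ext_expE // zpowN mulKg. Qed.

(** Along [t], the extended function changes by conjugation only, and this
    lowers the degree by [fixK]. *)
Lemma degree_lt_ext_part d (F : G -> K) :
  degree_lt M d F -> degree_lt (cyclic_ext t M) d (F \o ext_part).
Proof.
elim: d F => [|d IHd] F dF.
  by move=> x [i [m [Mm ->]]]; rewrite /= ext_partE // dF.
move=> h [i [u [Mu ->]]].
have conjM : hom_on M (conjg^~ (zpow t i)) by move=> x y _ _; exact: conjMg.
have conj_stable x : M x -> M (x ^ zpow t i) by exact: conj_zpow.
have dF' := degree_lt_comp sgM conjM conj_stable (dF u Mu).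
apply: eq_degree_lt (IHd _ (degree_ltD dF' (degree_lt_conj i dF))).
  exact: cyclic_ext_subgroup.
move=> x [j [m [Mm ->]]]; rewrite /diff /= cyclic_extM !ext_partE //.
  by rewrite addrA subrK.
by apply: subgroupM => //; exact: conj_stable.
Qed.

Section Exponent.
Variable v : nat.
Local Notation P := (p ^ v)%N.

Definition ext_res x : nat := absz (ext_exp x %% Posz P)%Z.

Let P_gt0 : (0 < P)%N.
Proof. by rewrite expn_gt0 prime_gt0 ?(pcharf_prime chK). Qed.

Lemma ext_resE i m : M m -> Posz (ext_res (zpow t i * m)) = (i %% Posz P)%Z.
Proof.
by move=> Mm; rewrite /ext_res ext_expE // gez0_abs // modz_ge0 // lt0n_neq0.
Qed.

Lemma ext_res_lt x : (ext_res x < P)%N.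
Proof.
by rewrite -ltz_nat /ext_res gez0_abs ?modz_ge0 ?lt0n_neq0 // ltz_pmod // ltz_nat.
Qed.

Lemma bin_res n r : (n < P)%N -> (r < P)%N ->
  ('C(r.+1 %% P, n.+1)%:R - 'C(r, n.+1)%:R = 'C(r, n)%:R :> K)%R
  \/ n.+1 = P.
Proof.
move=> ltnP ltrP; case: (ltngtP n.+1 P) => [ltSnP|ltPn|]; last by right.
  2: by rewrite ltnNge ltnP in ltPn.
left; case: (ltngtP r.+1 P) => [ltSrP|ltPr|eqrP].
- by rewrite modn_small // binS natrD addrAC subrr add0r.
- by rewrite ltnNge ltrP in ltPr.
rewrite eqrP modnn bin0n sub0r; apply/eqP; rewrite eq_sym -addr_eq0 -natrD.
rewrite addnC -binS eqrP; have pr_p := pcharf_prime chK.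
suff /dvdnP[k ->] : (p %| 'C(P, n.+1))%N by rewrite natrM (pcharf0 chK) mulr0.
apply/negPn/negP; rewrite -prime_coprime // => co.
have : (P %| n.+1 * 'C(P, n.+1))%N by rewrite -mul_bin_diag dvdn_mulr.
rewrite Gauss_dvdl ?coprimeXl // => /(dvdn_leq (ltn0Sn n)).
by rewrite leqNgt ltSnP.
Qed.

(** Modulo [p], the binomial coefficient [C(r, n)] depends only on [r] modulo
    [p ^ v] for [n < p ^ v], and Pascal's rule bounds its degree in [r]. *)
Lemma degree_lt_bin n : (n < P)%N ->
  degree_lt (cyclic_ext t M) n.+1 (fun x => 'C(ext_res x, n)%:R%R : K).
Proof.
have sgE := cyclic_ext_subgroup.
elim: n => [|n IHn] ltnP.
  have : degree_lt (cyclic_ext t M) 1 (fun=> 1%R : K) by exact: degree_lt_const.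
  by apply: degree_lt_ext => x; rewrite bin0.
apply: (@degree_lt_gen _ _ _ sgE (t |` M)).
- move=> h; apply: cyclic_ext_min; first exact: generated_subgroup.
    by apply: sub_generated; left.
  by move=> x Mx; apply: sub_generated; right.
- move=> a [->|Ma].
    apply: eq_degree_lt (IHn (ltnW ltnP)) => // x [i [m [Mm ->]]].
    rewrite /diff; set r := ext_res (zpow t i * m).
    have -> : ext_res (zpow t i * m * t) = (r.+1 %% P)%N.
      have -> : zpow t i * m * t = zpow t (i + 1)%R * m ^ t.
        by rewrite zpowS /conjg -!mulgA mulVKg.
      apply/eqP; rewrite -eqz_nat ext_resE; last by rewrite -nMt.
      by rewrite -modz_nat -addn1 PoszD ext_resE // modzDml.
    have [//|eqP] := bin_res (ltnW ltnP) (ext_res_lt (zpow t i * m)).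
    by rewrite eqP ltnn in ltnP.
  apply: eq_degree_lt (degree_lt_zero K (cyclic_ext t M) n.+1) => // x [i [m [Mm ->]]].
  apply/esym/eqP; rewrite /diff subr_eq0; apply/eqP; congr (_ %:R)%R; congr ('C(_, _)).
  apply/eqP; rewrite -eqz_nat -mulgA !ext_resE //.
  exact: subgroupM.
- move=> a [->|Ma]; [exact: cyclic_ext_gen|exact: sub_cyclic_ext].
Qed.

End Exponent.

(** Elements of [M] are separated by extended functions; [t ^ i * m] with [i] not
    zero is separated by binomial coefficients of the exponent modulo
    [p ^ absz i], which exceeds [absz i]. *)
Lemma separated_cyclic_ext : separated K M -> separated K (cyclic_ext t M).
Proof.
move=> sepM x [i [m [Mm defx]]] x1; have M1 := subgroup1 sgM.
have one : (1 : G) = zpow t 0 * 1 by rewrite mulg1.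
have [i0|i0] := eqVneq i 0%R.
  have m1 : m <> 1 by move=> m1; apply: x1; rewrite defx i0 m1 mulg1.
  have [d [F [dF Fm]]] := sepM m Mm m1.
  exists d, (F \o ext_part); split; first exact: degree_lt_ext_part.
  by rewrite /= defx ext_partE // one ext_partE.
pose v := absz i; pose r := ext_res v x.
have res_one : ext_res v 1 = 0%N.
  by apply/eqP; rewrite -eqz_nat one ext_resE // mod0z.
exists r.+1, (fun x => 'C(ext_res v x, r)%:R%R); split.
  by apply: degree_lt_bin; exact: ext_res_lt.
rewrite binn res_one bin0n; suff -> : (r == 0%N) = false by apply/eqP; exact: oner_neq0.
apply/negbTE; rewrite -eqz_nat /r defx ext_resE //.
rewrite (sameP eqP dvdz_mod0P) dvdzE /=.
rewrite gtnNdvd ?lt0n ?absz_eq0 // ltn_expl //.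
by rewrite prime_gt1 ?(pcharf_prime chK).
Qed.

End CyclicExt.

(** * Virtually nilpotent groups are virtually separated *)

Lemma comm_mulgl (G : groupType) (x y z : G) : [~ x * y, z] = [~ x, z] ^ y * [~ y, z].
Proof. by rewrite /commg /conjg !gnorm. Qed.

Lemma comm_mulgr (G : groupType) (x y z : G) : [~ x, y * z] = [~ x, z] * [~ x, y] ^ z.
Proof. by rewrite /commg /conjg !gnorm. Qed.

Lemma comm_invgl (G : groupType) (x y : G) : [~ x^-1, y] = ([~ x, y]^-1) ^ x^-1.
Proof. by rewrite /commg /conjg !gnorm. Qed.

Lemma comm_invgr (G : groupType) (x y : G) : [~ x, y^-1] = ([~ x, y]^-1) ^ y^-1.
Proof. by rewrite /commg /conjg !gnorm. Qed.

Section VirtuallySeparated.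
Variables (p q : nat) (K L : finFieldType).
Hypotheses (chK : p \in [pchar K]%R) (chL : q \in [pchar L]%R).
Variable G : groupType.
Implicit Types (M V W : set G) (t : G).

(** The same subgroup must serve both characteristics, as [separated_torsion_free]
    and [bounded_periods] combine them. *)
Definition virtually_separated M : Prop := exists V,
  [/\ is_subgroup V, V `<=` M, fin_index M V, separated K V & separated L V].

Lemma conj_hom_stable (R : finGroupType) M t : fingen M -> normalizes t M ->
  exists2 N, (0 < N)%N & forall k (chi : G -> R), hom_on M chi ->
    forall x, M x -> chi (x ^ (t ^+ (N * k)%N)) = chi x.
Proof.
move=> fgM nMt; have sgM := fingen_subgroup fgM.
have conjM : hom_on M (conjg^~ t) by move=> x y _ _; exact: conjMg.
have [N N_gt0 NP] := hom_iter_stable R fgM conjM (fun x => (nMt x).1).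
have iterE k x : iter k (conjg^~ t) x = x ^ (t ^+ k).
  by elim: k => [|k IHk]; rewrite ?conjg1 //= IHk -conjgM -expgSr.
exists N => // k chi chiM x Mx; rewrite expgnA.
have nMtN := normalizes_exp nMt N.
elim: k => [|k IHk]; first by rewrite conjg1.
set y := x ^ (t ^+ N) ^+ k in IHk *; rewrite expgSr conjgM -/y -IHk.
have My : M y by exact: (normalizes_exp nMtN k x).1.
have Mz : M (y ^ (t ^+ N)^-1) by rewrite nMtN conjgKV.
by have := NP chi chiM _ Mz; rewrite !iterE conjgKV.
Qed.

Lemma virtually_separated_trans M V : is_subgroup M -> is_subgroup V -> V `<=` M ->
  fin_index M V -> virtually_separated V -> virtually_separated M.
Proof.
move=> sgM sgV sVM finV [W [sgW sWV finW sepK sepL]]; exists W; split=> //.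
  exact: subset_trans sVM.
exact: fin_index_trans finW.
Qed.

Lemma subgroup_zpow W t i : is_subgroup W -> W t -> W (zpow t i).
Proof.
by move=> sgW Wt; case: i => n /=; [|apply: subgroupV => //]; exact: subgroupX.
Qed.

Definition int_label (n : nat) (i : int) : 'I_n.-1.+1 := inord (absz (i %% Posz n)%Z).

Lemma int_labelP n i j : (0 < n)%N -> int_label n i = int_label n j ->
  exists k, j = (i + k * n%:Z)%R.
Proof.
move=> n_gt0 /(congr1 val) /=; have lt_n m : (absz (m %% Posz n)%Z < n.-1.+1)%N.
  rewrite prednK // -ltz_nat gez0_abs ?modz_ge0 ?lt0n_neq0 //.
  by rewrite ltz_pmod // ltz_nat.
rewrite !inordK // => /eqP; rewrite -eqz_nat !gez0_abs ?modz_ge0 ?lt0n_neq0 //.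
rewrite eq_sym eqz_mod_dvd => /dvdzP[k E]; exists k.
by rewrite -E addrC subrK.
Qed.

(** A suitable power [s] of [t] acts trivially on the homomorphisms from a
    characteristic subgroup [W] of finite index in [M] to both fields, and on
    [M / W]; then [W <s>] has finite index in [M <t>]. It is separated if [s ^ i]
    lies in [W] for [i = 0] only; otherwise [W] itself has finite index in it. *)
Lemma virtually_separated_cyclic_ext M t : fingen M -> normalizes t M ->
  virtually_separated M -> virtually_separated (cyclic_ext t M).
Proof.
move=> fgM nMt [V [sgV sVM finV sepK sepL]].
have sgM := fingen_subgroup fgM.
have [T [pi [piM piV]]] := fin_index_hom sgM sgV sVM finV.
pose W := hom_core {perm T} M.
have sgW : is_subgroup W by exact: hom_core_subgroup.
have sWM : W `<=` M by exact: hom_core_sub.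
have sWV : W `<=` V by move=> x [Mx coreW]; apply: piV => //; exact: coreW.
have finW : fin_index M W by exact: hom_core_fin_index.
have fgW : fingen W by exact: fingen_fin_index finW.
have nMt' x : M x -> M (x ^ t^-1) by rewrite [M (_ ^ _)]nMt conjgKV.
have nWt : normalizes t W.
  move=> x; split.
    apply: (hom_core_stable (f := conjg^~ t)) => [y z _ _|y]; first exact: conjMg.
    by rewrite -nMt.
  rewrite -{2}(conjgK t x).
  by apply: (hom_core_stable (f := conjg^~ t^-1)) => // y z _ _; exact: conjMg.
have [N1 N1_gt0 N1P] := conj_hom_stable {perm T} fgM nMt.
have [N2 N2_gt0 N2P] := conj_hom_stable K fgW nWt.
have [N3 N3_gt0 N3P] := conj_hom_stable L fgW nWt.
pose N := (N1 * N2 * N3)%N; pose s := t ^+ N.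
have N_gt0 : (0 < N)%N by rewrite !muln_gt0 N1_gt0 N2_gt0.
have nWs : normalizes s W by exact: normalizes_exp.
have nMs : normalizes s M by exact: normalizes_exp.
have sM1 k (chi : G -> {perm T}) : hom_on M chi ->
    forall x, M x -> chi (x ^ zpow s k) = chi x.
  move=> chiM; have step x : M x -> chi (x ^ s) = chi x.
    by move=> Mx; rewrite /s /N -mulnA N1P.
  elim/int_rect: k => [|n IHn|n IHn] x Mx; first by rewrite conjg1.
    rewrite -addn1 PoszD zpowS conjgM step ?IHn //.
    exact: conj_zpow.
  rewrite -addn1 PoszD opprD zpowB1 conjgM -step ?conjgKV ?IHn //.
  by rewrite nMs conjgKV; exact: conj_zpow.
have sW x : M x -> forall k, W ((x ^ zpow s k)^-1 * x).
  move=> Mx k; have Mxk : M (x ^ zpow s k) by exact: conj_zpow.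
  split=> [|chi chiM]; first exact: subgroupVl.
  apply: (mulgI (chi (x ^ zpow s k))).
  by rewrite -chiM ?mulVKg ?mulg1 ?sM1 //; exact: subgroupVl.
have sgM1 := cyclic_ext_subgroup sgM nMt.
have sgV1 := cyclic_ext_subgroup sgW nWs.
have sV1 : cyclic_ext s W `<=` cyclic_ext t M.
  apply: cyclic_ext_min => //; last by move=> x /sWM Mx; exact: sub_cyclic_ext.
  by apply: subgroupX => //; exact: cyclic_ext_gen.
apply: (virtually_separated_trans sgM1 sgV1 sV1).
  have [T' [f fP]] := finW.
  pose dec x := xget (0%R, 1) [set im : int * G | M im.2 /\ x = zpow t im.1 * im.2].
  exists ('I_N.-1.+1 * T')%type, (fun x => (int_label N (dec x).1, f (dec x).2)).
  have decP x : cyclic_ext t M x -> M (dec x).2 /\ x = zpow t (dec x).1 * (dec x).2.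
    move=> [i [m [Mm defx]]].
    exact: (@xgetI _ (0%R, 1) [set im : int * G | M im.2 /\ x = zpow t im.1 * im.2]
      (i, m)).
  move=> x y /decP; case: (dec x) => i m /= [Mm ->] /decP.
  case: (dec y) => j n /= [Mn ->] [] eqN /(fP _ _ Mm Mn) Wmn.
  have [k {}eqN] := int_labelP N_gt0 eqN.
  exists k, ((m ^ zpow s k)^-1 * m * (m^-1 * n)); split.
    by apply: subgroupM => //; exact: sW.
  rewrite eqN zpowD zpowM -/s /conjg !invgM !invgK -!mulgA.
  by rewrite !(mulKg, mulVKg).
have [[i0 i0_neq0 Wsi]|inf_s] := pselect (exists2 i, i != 0%R & W (zpow s i)).
  exists W; split=> //; [exact: sub_cyclic_ext|..].
  - have Wsn : W (s ^+ absz i0).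
      case: i0 {i0_neq0} Wsi => n //= Wsn.
      by rewrite -[_ ^+ _]invgK; exact: subgroupV.
    pose dec x := xget (0%R, 1) [set im : int * G | W im.2 /\ x = zpow s im.1 * im.2].
    exists ('I_(absz i0).-1.+1), (fun x => int_label (absz i0) (dec x).1).
    have decP x : cyclic_ext s W x -> W (dec x).2 /\ x = zpow s (dec x).1 * (dec x).2.
      move=> [j [m [Wm defx]]].
      exact: (@xgetI _ (0%R, 1) [set im : int * G | W im.2 /\ x = zpow s im.1 * im.2]
        (j, m)).
    move=> x y /decP; case: (dec x) => j w /= [Ww ->] /decP.
    case: (dec y) => j' w' /= [Ww' ->] /int_labelP[|k ->]; first by rewrite absz_gt0.
    rewrite zpowD zpowM invgM -!mulgA mulKg.
    by apply: subgroupVl => //; apply: subgroupM => //; exact: subgroup_zpow.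
  - exact: separated_sub sepK.
  - exact: separated_sub sepL.
have {}inf_s i : W (zpow s i) -> i = 0%R.
  by move=> Wsi; apply/eqP/negPn/negP => i0; apply: inf_s; exists i.
exists (cyclic_ext s W); split=> //.
- by exists 'I_1, (fun=> ord0) => x y V1x V1y _; exact: subgroupVl.
- apply: (separated_cyclic_ext sgW nWs chK _ inf_s); last exact: separated_sub sepK.
  by move=> chi chiM x Wx; rewrite /s /N mulnAC mulnC N2P.
- apply: (separated_cyclic_ext sgW nWs chL _ inf_s); last exact: separated_sub sepL.
  by move=> chi chiM x Wx; rewrite /s /N mulnC N3P.
Qed.

Lemma virtually_separated1 : virtually_separated [set 1].
Proof.
exists [set 1]; split=> //.
- by split=> [|x y /= -> ->|x /= ->]; rewrite ?mulg1 ?invg1.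
- by exists 'I_1, (fun=> ord0) => x y /= -> ->; rewrite mulg1 invg1.
Qed.

Lemma fingen1 : fingen [set (1 : G)].
Proof.
exists [::]; apply/seteqP; split; last by apply: generated_min;
  first split=> [|x y /= -> ->|x /= ->]; rewrite ?mulg1 ?invg1.
by move=> x ->; apply: subgroup1; exact: generated_subgroup.
Qed.

(** The elements of [s] are adjoined one at a time: as their commutators with [H]
    lie in [M], they normalize every subgroup between [M] and [H]. *)
Lemma virtually_separated_central M H (s : seq G) : is_subgroup H -> M `<=` H ->
    (forall a, a \in s -> H a /\ forall x, H x -> M [~ x, a]) ->
    fingen M -> virtually_separated M ->
  exists M', [/\ fingen M', virtually_separated M', M `<=` M' , M' `<=` H &
    M' = generated (M `|` [set` s])].
Proof.
move=> sgH sMH; elim: s => [|a s IHs] sP fgM sepM.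
  exists M; split=> //; apply/seteqP; split=> [x Mx|]; first by apply: sub_generated;
    left.
  apply: generated_min => [|x [//|]]; last by rewrite /=.
  exact: fingen_subgroup.
have [|M' [fgM' sepM' sMM' sM'H defM']] := IHs _ fgM sepM.
  by move=> b sb; apply: sP; rewrite inE sb orbT.
have [Ha aP] := sP a (mem_head a s).
have sgM' := fingen_subgroup fgM'.
have conjE x : H x -> M' (x ^ a) <-> M' x.
  move=> Hx; have Mxa := sMM' _ (aP x Hx); split=> M'x.
    by apply: (subgroupMr sgM' Mxa); rewrite commgEl mulVKg.
  by have := subgroupM sgM' M'x Mxa; rewrite commgEl mulVKg.
have nM'a : normalizes a M'.
  move=> x; split=> M'x; first by apply/conjE => //; exact: sM'H.
  apply/conjE => //; rewrite -(conjgK a x) /conjg.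
  by apply: subgroupM; [| |apply: subgroupM]; rewrite ?invgK //;
    [exact: sM'H|exact: subgroupV].
exists (cyclic_ext a M'); split.
- exact: cyclic_ext_fingen.
- exact: virtually_separated_cyclic_ext.
- by move=> x /sMM' M'x; exact: sub_cyclic_ext.
- exact: cyclic_ext_min.
apply/seteqP; split; last first.
  apply: generated_min; first exact: cyclic_ext_subgroup.
  move=> x [/sMM' M'x|/=]; first exact: sub_cyclic_ext.
  rewrite inE => /orP[/eqP ->|sx]; first exact: cyclic_ext_gen.
  by apply: sub_cyclic_ext; rewrite defM'; apply: sub_generated; right.
apply: cyclic_ext_min; first exact: generated_subgroup.
  by apply: sub_generated; right; exact: mem_head.
rewrite defM'; apply: generated_min; first exact: generated_subgroup.
by move=> x [Mx|sx]; apply: sub_generated; [left|right; rewrite /= inE sx orbT].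
Qed.

Section LowerCentral.
Variable H : set G.
Hypothesis sgH : is_subgroup H.
Local Notation gamma := (lower_central H).

Lemma lower_central_subgroup m : is_subgroup (gamma m).
Proof. by case: m => [//|m]; exact: generated_subgroup. Qed.

Lemma lower_central_sub_normal m :
  gamma m `<=` H /\ forall x h, gamma m x -> H h -> gamma m (x ^ h).
Proof.
have conjH x h : H x -> H h -> H (x ^ h).
  by move=> Hx Hh; rewrite /conjg; do ?apply: subgroupM => //; exact: subgroupV.
elim: m => [|m [sgm ngm]] /=; first by split=> // x h; exact: conjH.
have sub : gamma m.+1 `<=` H.
  apply: generated_min => // z [x [y [gx Hy ->]]]; rewrite commgEl.
  by apply: subgroupVl => //; [exact: sgm|by apply: sgm; exact: ngm].
split=> // x h + Hh.
suff : gamma m.+1 `<=` [set x | gamma m.+1 (x ^ h)] by apply.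
have sgS := lower_central_subgroup m.+1.
apply: generated_min => [|z [y [k [gy Hk ->]]]] /=; last first.
  apply: sub_generated; exists (y ^ h), (k ^ h); rewrite conjRg.
  by split=> //; [exact: ngm|exact: conjH].
split=> [|y z /= gy gz|y /= gy]; first by rewrite /= conj1g; exact: (subgroup1 sgS).
  by rewrite conjMg; exact: (subgroupM sgS).
by rewrite conjVg; exact: (subgroupV sgS).
Qed.

Lemma lower_central_sub m : gamma m `<=` H.
Proof. by case: (lower_central_sub_normal m). Qed.

Lemma lower_central_conj m x h : gamma m x -> H h -> gamma m (x ^ h).
Proof. by case: (lower_central_sub_normal m) => _; apply. Qed.

Lemma lower_central_comm m x h : gamma m x -> H h -> gamma m.+1 [~ x, h].
Proof. by move=> gx Hh; apply: sub_generated; exists x, h. Qed.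

Lemma lower_centralS m : gamma m.+1 `<=` gamma m.
Proof.
have sg := lower_central_subgroup m.
apply: generated_min => // z [x [y [gx Hy ->]]]; rewrite commgEl.
by apply: subgroupVl => //; exact: lower_central_conj.
Qed.

(** Modulo the next term the commutator is a homomorphism in each argument, so
    the commutators of generators suffice. *)
Lemma lower_central_gen m : fingen H -> exists2 s : seq G,
  (forall a, a \in s -> gamma m a) & gamma m `<=` generated (gamma m.+1 `|` [set` s]).
Proof.
move=> [s0 defH]; have Hs0 b : b \in s0 -> H b.
  by move=> sb; rewrite defH; exact: sub_generated.
elim: m => [|m [s gs gen]].
  exists s0 => // x; rewrite /= {1}defH; move: x; apply: generated_min.
    exact: generated_subgroup.
  by move=> x sx; apply: sub_generated; right.
exists [seq [~ a, b] | a <- s, b <- s0].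
  move=> z /allpairsP[[a b]] [/= sa sb ->].
  by apply: lower_central_comm; [exact: gs|exact: Hs0].
set D := generated _; have sgD : is_subgroup D by exact: generated_subgroup.
have gD : gamma m.+2 `<=` D by move=> x gx; apply: sub_generated; left.
have Dg : D `<=` gamma m.+1.
  apply: generated_min; first exact: lower_central_subgroup.
  move=> x [/lower_centralS //|/= /allpairsP[[a b]] [/= sa sb ->]].
  by apply: lower_central_comm; [exact: gs|exact: Hs0].
have nD x h : D x -> H h -> D (x ^ h).
  move=> Dx Hh; rewrite -[x ^ h](mulVKg x) -commgEl; apply: (subgroupM sgD Dx).
  by apply: gD; apply: lower_central_comm => //; exact: Dg.
have sgm := lower_central_subgroup m; have Hm := @lower_central_sub m.
have comm_gen b : b \in s0 -> gamma m `<=` [set x | gamma m x /\ D [~ x, b]].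
  move=> sb; have Hb := Hs0 b sb; move=> x /gen; move: x; apply: generated_min.
    split=> [|x y [gx Dx] [gy Dy]|x [gx Dx]].
    - by split; [exact: subgroup1|rewrite comm1g; exact: subgroup1].
    - split; first exact: subgroupM.
      by rewrite comm_mulgl; apply: (subgroupM sgD) => //; apply: nD => //; exact: Hm.
    - split; first exact: subgroupV.
      rewrite comm_invgl; apply: nD; [exact: (subgroupV sgD)|apply: (subgroupV sgH);
        exact: Hm].
  move=> x [gx|/= sx]; split.
  - exact: lower_centralS.
  - by apply: gD; exact: lower_central_comm.
  - exact: gs.
  - by apply: sub_generated; right; apply/allpairsP; exists (x, b).
apply: generated_min => // z [x [y [gx Hy ->]]]; have Hx := Hm x gx.
suff HD : H `<=` [set y | H y /\ D [~ x, y]] by case: (HD y Hy).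
rewrite {1}defH; apply: generated_min.
  split=> [|y1 y2 [Hy1 Dy1] [Hy2 Dy2]|y1 [Hy1 Dy1]].
  - by split; [exact: subgroup1|rewrite commg1; exact: subgroup1].
  - split; first exact: subgroupM.
    by rewrite comm_mulgr; apply: (subgroupM sgD) => //; exact: nD.
  - split; first exact: subgroupV.
    rewrite comm_invgr; apply: nD; [exact: (subgroupV sgD)|exact: (subgroupV sgH)].
by move=> b sb; split; [exact: Hs0|case: (comm_gen b sb x gx)].
Qed.

Lemma nilpotent_virtually_separated n :
  fingen H -> gamma n = [set 1] -> virtually_separated H.
Proof.
move=> fgH gn; suff : forall k, fingen (gamma (n - k))
  /\ virtually_separated (gamma (n - k)).
  by move/(_ n) => []; rewrite subnn.
elim=> [|k [fgk sepk]].
  by rewrite subn0 gn; split; [exact: fingen1|exact: virtually_separated1].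
have [lenk|ltkn] := leqP n k.
  suff -> : (n - k.+1 = n - k)%N by [].
  by apply/eqP; rewrite subnS; move: lenk; rewrite -subn_eq0 => /eqP ->.
move: fgk sepk; rewrite -(subnSK ltkn); set m := (n - k.+1)%N => fgm sepm.
have [s gs gen] := lower_central_gen m fgH.
have [a sa|M' [fgM' sepM' sMM' _ defM']] :=
    virtually_separated_central sgH (@lower_central_sub m.+1) (s := s) _ fgm sepm.
  have ga := gs a sa; split; first exact: lower_central_sub ga.
  move=> x Hx; rewrite -invgR; apply: (subgroupV (lower_central_subgroup m.+1)).
  exact: lower_central_comm.
suff -> : gamma m = M' by [].
apply/seteqP; split; first by rewrite defM'.
rewrite defM'; apply: generated_min; first exact: lower_central_subgroup.
by move=> x [/lower_centralS|/gs].
Qed.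

End LowerCentral.

End VirtuallySeparated.

Lemma finitely_generated_fingen (G : groupType) :
  finitely_generated G -> fingen [set: G].
Proof. by case=> A /finite_seqP[s ->] genA; exists s. Qed.

Lemma finite_index_fin_index (G : groupType) (H : set G) :
  is_subgroup H -> finite_index H -> fin_index [set: G] H.
Proof.
move=> sgH /finite_seqP[s defs].
pose coset (x : G) : set G := [set x * h | h in H].
have mem x : coset x \in s.
  have : [set coset x | x in [set: G]] (coset x) by exists x.
  by rewrite defs.
exists 'I_(size s), (fun x => Ordinal (etrans (index_mem _ _) (mem x))).
move=> x y _ _ /(congr1 val) /= eqi.
have eqc : coset x = coset y.
  by rewrite -(nth_index set0 (mem x)) eqi nth_index.
have : coset x y by rewrite eqc; exists 1; [exact: subgroup1|rewrite mulg1].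
by case=> h Hh <-; rewrite mulKg.
Qed.

Theorem virtually_nilpotent_separated (p q : nat) (K L : finFieldType) (G : groupType) :
    p \in [pchar K]%R -> q \in [pchar L]%R ->
    finitely_generated G -> virtually_nilpotent G ->
  virtually_separated K L [set: G].
Proof.
move=> chK chL /finitely_generated_fingen fgG [H [sgH [n Hn]] finH].
have {}finH := finite_index_fin_index sgH finH.
apply: (virtually_separated_trans (fingen_subgroup fgG) sgH (@subsetT _ _) finH).
apply: (nilpotent_virtually_separated chK chL sgH) Hn.
exact: (fingen_fin_index fgG sgH (@subsetT _ _) finH).
Qed.

(** * Universal properties *)

Section Morphisms.
Variables (G K : groupType) (f : G -> K).
Hypothesis fM : {morph f : x y / x * y}.

Lemma morph1g : f 1 = 1.
Proof. by apply: (mulgI (f 1)); rewrite -fM !mulg1. Qed.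

Lemma morphVg x : f x^-1 = (f x)^-1.
Proof. by apply: (mulgI (f x)); rewrite -fM !mulgV morph1g. Qed.

End Morphisms.

Lemma free_group_lift (X : choiceType) (K : groupType) (f : X -> K) :
  exists2 rho : free_group X -> K, {morph rho : x y / x * y} &
    forall x, rho (free_gen x) = f x.
Proof.
pose letter (l : X * bool) := if l.2 then f l.1 else (f l.1)^-1.
pose eval w := foldr (fun l acc => letter l * acc) 1 w.
have evalM u v : eval (u ++ v) = eval u * eval v.
  by elim: u => [|l u IHu] /=; rewrite ?mul1g // IHu mulgA.
have eval_eq u v : free_eq u v -> eval u = eval v.
  elim=> // [u1 u2 u3 _ -> _ -> //|u1 x b v1].
  by rewrite !evalM /letter; case: b; rewrite /= (mulVKg, mulKg).
have evalK w : eval (repr (free_pi w)) = eval w.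
  by apply/eval_eq/free_piP; rewrite free_reprK.
exists (fun a => eval (repr a)) => [a b|x]; last by rewrite evalK /= mulg1.
by rewrite [a * b]/(free_mul a b) evalK evalM.
Qed.

Lemma quotient_lift (G K : groupType) (A : set G) (f : G -> K) :
    {morph f : x y / x * y} -> (forall a, A a -> f a = 1) ->
  exists2 rho : quotient A -> K, {morph rho : x y / x * y} &
    forall x, rho (quotient_pi A x) = f x.
Proof.
move=> fM fA; have ker x : normal_closure A x -> f x = 1.
  move/(_ [set x | f x = 1]); apply; split=> //; split; last first.
    by move=> y z /= fy; rewrite /conjg !fM fy mul1g -fM mulVg morph1g.
  split=> /= [|y z fy fz|y fy]; first exact: morph1g.
    by rewrite fM fy fz mulg1.
  by rewrite morphVg // fy invg1.
have fK x : f (repr (quotient_pi A x)) = f x.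
  have /quotient_piP/ker : quotient_pi A (repr (quotient_pi A x)) = quotient_pi A x.
    by rewrite quotient_reprK.
  by rewrite fM morphVg // => E; apply: (mulgI (f (repr (quotient_pi A x)))^-1);
    rewrite E mulVg.
exists (fun a => f (repr a)) => [a b|x]; last exact: fK.
by rewrite [a * b]/(quotient_mul a b) fK fM.
Qed.

Lemma quotient_pi_morph (G : groupType) (A : set G) :
  {morph quotient_pi A : x y / x * y}.
Proof. exact: quotient_piM. Qed.

Lemma quotient_pi_rel (G : groupType) (A : set G) x : A x -> quotient_pi A x = 1.
Proof.
move=> Ax; apply/esym/quotient_piP; rewrite invg1 mul1g => L [_]; exact.
Qed.

Section FreeProductLift.
Variables (I : choiceType) (H : I -> groupType).

Lemma free_product_lift (K : groupType) (f : forall i, H i -> K) :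
    (forall i, {morph f i : x y / x * y}) ->
  exists2 rho : free_product H -> K, {morph rho : x y / x * y} &
    forall i (x : H i), rho (free_product_in x) = f i x.
Proof.
move=> fM; have [rho rhoM rhoE] := free_group_lift (fun u : {i : I & H i} =>
  f (tag u) (tagged u)).
have [|sg sgM sgE] := @quotient_lift _ _ (free_product_relators (H := H)) rho rhoM.
  by move=> _ [i [x [y ->]]]; rewrite !rhoM morphVg // !rhoE /= fM mulgV.
by exists sg => // i x; rewrite [LHS]sgE rhoE.
Qed.

Lemma free_product_inM i (x y : H i) :
  free_product_in (x * y) = free_product_in x * free_product_in y.
Proof.
set R := free_product_relators (H := H).
have : quotient_pi R (free_product_gen x * free_product_gen y
                      * (free_product_gen (x * y))^-1) = 1.
  by apply: quotient_pi_rel; exists i, x, y.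
by rewrite !quotient_pi_morph (morphVg (@quotient_pi_morph _ R)) => /divg1_eq.
Qed.

Lemma free_product_in1 i : free_product_in (1 : H i) = 1.
Proof. exact: morph1g (@free_product_inM i). Qed.

Lemma free_product_inV i (x : H i) : free_product_in x^-1 = (free_product_in x)^-1.
Proof. exact: morphVg (@free_product_inM i) x. Qed.

Lemma free_product_ind (P : free_product H -> Prop) : P 1 ->
  (forall g i (x : H i), P g -> P (g * free_product_in x)) -> forall g, P g.
Proof.
move=> P1 PM g; rewrite -[g](quotient_reprK) -[repr g](free_reprK).
elim/last_ind: (repr (repr g)) => [//|w [[i x] b] IHw].
rewrite -cats1 free_piM [quotient_pi _ _]quotient_pi_morph.
case: b; first exact: (PM _ i x).
suff -> : quotient_pi (free_product_relators (H :=
  H)) (free_pi [:: (Tagged H x, false)])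
    = free_product_in x^-1 by exact: PM.
by rewrite free_product_inV -(morphVg (@quotient_pi_morph _ _))
  -[(free_product_gen x)^-1]free_piV.
Qed.

End FreeProductLift.

Section Bijections.
Variable V : Type.

(** The target of [free_product_lift] when a free product is made to act on an
    infinite set. *)
Record bijection := Bijection {
  bij_fun :> V -> V;
  bij_inv : V -> V;
  bij_funK : cancel bij_fun bij_inv;
  bij_invK : cancel bij_inv bij_fun }.

HB.instance Definition _ := gen_eqMixin bijection.
HB.instance Definition _ := gen_choiceMixin bijection.

Lemma bijection_eq (f g : bijection) : f =1 g -> f = g.
Proof.
case: f g => [f f' fK f'K] [g g' gK g'K] /= /funext eqfg.
have eqfg' : f' = g'.
  by apply/funext => x; rewrite -{1}(g'K x) -eqfg fK.
by move: fK f'K gK g'K; rewrite eqfg eqfg' => *; congr Bijection;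
  exact: Prop_irrelevance.
Qed.

Definition bij_mul (f g : bijection) : bijection :=
  Bijection (can_comp (bij_funK f) (bij_funK g)) (can_comp (bij_invK g) (bij_invK f)).
Definition bij_one : bijection := @Bijection id id (fun=> erefl) (fun=> erefl).
Definition bij_invg (f : bijection) : bijection := Bijection (bij_invK f) (bij_funK f).

Lemma bij_mulA : associative bij_mul. Proof. by move=> f g h; exact: bijection_eq. Qed.
Lemma bij_mul1 : left_id bij_one bij_mul. Proof. by move=> f; exact: bijection_eq. Qed.
Lemma bij_mulg1 : right_id bij_one bij_mul. Proof. by move=> f;
  exact: bijection_eq. Qed.
Lemma bij_mulV : left_inverse bij_one bij_invg bij_mul.
Proof. by move=> f; apply: bijection_eq; exact: bij_funK. Qed.
Lemma bij_mulgV : right_inverse bij_one bij_invg bij_mul.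
Proof. by move=> f; apply: bijection_eq; exact: bij_invK. Qed.

HB.instance Definition _ := isGroup.Build bijection
  bij_mulA bij_mul1 bij_mulg1 bij_mulV bij_mulgV.

Lemma bijM (f g : bijection) v : (f * g) v = f (g v). Proof. by []. Qed.

End Bijections.

(** * Reduced words in free products *)

Section FreeProductSeparated.
Variables (I : choiceType) (H : I -> groupType) (K : finFieldType).
Local Notation Gamma := (free_product H).
Local Notation letter := (@free_product_in I H _).

Section AppendSyllable.
Variables (c : I) (Phi' : Gamma -> K).
Hypothesis Phi'_inv : forall g (a : H c), Phi' (g * letter a) = Phi' g.

Local Notation V := ((Gamma -> K) * (H c -> K))%type.

Let actc (a : H c) (v : V) : V :=
  ((fun g => v.1 (g * letter a)%g + (v.2 a - v.2 1%g) * Phi' g)%R,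
   (fun x => v.2 (x * a))).

Let act i : H i -> V -> V :=
  match pselect (c = i) with
  | left e => match e in _ = j return H j -> V -> V with erefl => actc end
  | right _ => fun b v => ((fun g => v.1 (g * letter b)), v.2)
  end.

Let act_c : @act c = actc.
Proof.
by rewrite /act; case: pselect => // e; rewrite (Prop_irrelevance e erefl).
Qed.

Let act_other i (b : H i) v : i != c -> act b v = ((fun g => v.1 (g * letter b)), v.2).
Proof. by move=> ic; rewrite /act; case: pselect => // e; rewrite e eqxx in ic. Qed.

Let actM i (a b : H i) v : act (a * b) v = act a (act b v).
Proof.
have [ic|ic] := eqVneq i c; last first.
  rewrite !act_other //=; congr pair; apply/funext => g.
  by rewrite free_product_inM mulgA.
case: _ / (esym ic) a b => a b; rewrite act_c /actc /=.
congr pair; apply/funext => g.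
  by rewrite free_product_inM mulgA Phi'_inv mul1g; ring.
by rewrite mulgA.
Qed.

Let act1 i v : act (1 : H i) v = v.
Proof.
case: v => Psi f; have [ic|ic] := eqVneq i c; last first.
  by rewrite act_other //=; congr pair; apply/funext => g;
    rewrite free_product_in1 mulg1.
case: _ / (esym ic); rewrite act_c /actc /=; congr pair; apply/funext => g.
  by rewrite free_product_in1 mulg1 subrr mul0r addr0.
by rewrite mulg1.
Qed.

Let act_bij i (a : H i) : bijection V.
Proof.
by exists (act a) (act a^-1) => v; rewrite -actM ?mulVg ?mulgV act1.
Defined.

(** Read letters from the right: [Phi f] sums, over the letters [a] of colour
    [c], the increment that [a] causes in the current translate of [f], times
    [Phi'] of the letters not yet read. It is the matrix coefficient of an
    action of the free product on pairs of functions, glued along [Phi']. *)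
Lemma append_syllable : exists Phi : (H c -> K) -> Gamma -> K,
  [/\ forall f, Phi f 1 = 0%R,
      forall f g (a : H c), Phi f (g * letter a)
        = ((f a - f 1%g) * Phi' g + Phi (fun x => f (x * a)%g) g)%R &
      forall f g i (b : H i), i != c -> Phi f (g * letter b) = Phi f g].
Proof.
have [|rho rhoM rhoE] := @free_product_lift I H (bijection V) (fun i a => act_bij a).
  by move=> i a b; apply: bijection_eq => v; exact: actM.
pose Phi f g : K := (rho g ((fun=> 0%R), f)).1 1.
have split g Psi f y : (rho g (Psi, f)).1 y
    = (Psi (y * g)%g + (rho g ((fun=> 0%R), f)).1 y)%R.
  elim/free_product_ind: g Psi f => [|g i a IHg] Psi f.
    by rewrite (morph1g rhoM) /= mulg1 addr0.
  rewrite rhoM rhoE !bijM /=; have [ic|ic] := eqVneq i c; last first.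
    by rewrite !act_other //= IHg mulgA.
  case: _ / (esym ic) a => a; rewrite act_c /actc /= [LHS]IHg [in RHS]IHg.
  by rewrite mulgA; ring.
exists Phi; split=> [f|f g a|f g i b ic].
- by rewrite /Phi (morph1g rhoM).
- by rewrite /Phi rhoM rhoE bijM /= act_c /actc /= split mul1g add0r.
- by rewrite /Phi rhoM rhoE bijM /= act_other.
Qed.

End AppendSyllable.

Definition syllable := {i : I & H i}.

(** Words are read from right to left: the head of the list is the last letter. *)
Fixpoint word_prod (s : seq syllable) : Gamma :=
  if s is x :: u then word_prod u * letter (tagged x) else 1.

Definition last_colour_neq (i : I) (s : seq syllable) : bool :=
  if s is x :: _ then i != tag x else true.

Fixpoint reduced (s : seq syllable) : Prop :=
  if s is x :: u then
    [/\ tagged x <> 1, last_colour_neq (tag x) u & reduced u]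
  else True.

Fixpoint vanishes (Phi : Gamma -> K) (s : seq syllable) : Prop :=
  if s is _ :: u then Phi (word_prod u) = 0%R /\ vanishes Phi u else True.

Hypothesis sepH : forall i, separated K [set: H i].

Lemma subgroupT (G : groupType) : is_subgroup [set: G]. Proof. by []. Qed.

(** The induction needs that [Phi] vanishes on the proper initial segments of
    the word, so that only one path through the glued actions contributes, and
    that [Phi] ignores final letters of all colours but the last one, so that
    the next colour can be glued. *)
Lemma reduced_coefficient s : reduced s -> exists d (Phi : Gamma -> K),
  [/\ degree_lt [set: Gamma] d Phi, Phi (word_prod s) != 0%R, vanishes Phi s &
      forall i, last_colour_neq i s ->
        forall g (b : H i), Phi (g * letter b) = Phi g].
Proof.
elim: s => [|[c a] s IHs] /=.
  move=> _; exists 1%N, (fun=> 1%R); split=> //;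
    [exact: degree_lt_const|exact: GRing.oner_neq0].
move=> [/= a1 neq_c /IHs[D [Phi' [dPhi' Phi's van inv]]]].
have inv_c g (b : H c) : Phi' (g * letter b) = Phi' g by exact: (inv c neq_c).
have [Phi [Phi_1 Phi_c Phi_other]] := append_syllable inv_c.
have [e [f [df fa]]] := sepH Logic.I a1.
have van_f u h : vanishes Phi' u -> Phi h (word_prod u) = 0%R.
  elim: u h => [|[i b] u IHu] h /=; first by rewrite Phi_1.
  move=> [Phi'u vanu]; have [ic|ic] := eqVneq i c; last first.
    by rewrite Phi_other // IHu.
  case: _ / (esym ic) b => b; rewrite Phi_c Phi'u mulr0 add0r IHu //.
have van_all u h : vanishes Phi' u -> vanishes (Phi h) u.
  elim: u h => [//|y u IHu] h /= [Phi'u vanu].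
  by split; [exact: van_f|exact: IHu].
have Phi_D h k g : Phi (fun x => h x - k x)%R g = (Phi h g - Phi k g)%R.
  elim/free_product_ind: g h k => [|g i b IHg] h k; first by rewrite !Phi_1 subr0.
  have [ic|ic] := eqVneq i c; last by rewrite !Phi_other.
  case: _ / (esym ic) b => b; rewrite !Phi_c (IHg (fun x => h (x * b))).
  by ring.
have Phi_0 g : Phi (fun=> 0%R) g = 0%R.
  have -> : (fun=> 0%R) = (fun x : H c => 0 - 0)%R :> (H c -> K).
    by apply/funext => x; rewrite subr0.
  by rewrite Phi_D subrr.
have degPhi n h : degree_lt [set: H c] n h -> degree_lt [set: Gamma] (n + D) (Phi h).
  elim: n h => [|n IHn] h dh.
    have -> : h = (fun=> 0%R) by apply/funext => x; exact: dh.
    by apply: degree_lt_ext (degree_lt_zero K _ _) => g; rewrite Phi_0.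
  rewrite addSn; pose A := [set g : Gamma | exists i (b : H i), g = letter b].
  apply: (@degree_lt_gen _ _ _ (@subgroupT _) A) => //.
    have sgA := generated_subgroup A.
    move=> g _; elim/free_product_ind: g => [|g i b IHg]; first exact: (subgroup1 sgA).
    by apply: (subgroupM sgA IHg); apply: sub_generated; exists i, b.
  move=> _ [i [b ->]]; have [ic|ic] := eqVneq i c; last first.
    apply: degree_lt_ext (degree_lt_zero K _ _) => g.
    by rewrite /diff Phi_other // subrr.
  case: _ / (esym ic) b => b.
  have dPhi'b : degree_lt [set: Gamma] (n + D) (fun g => (h b - h 1%g) * Phi' g)%R.
    apply: (degree_lt_leq (@subgroupT _) (leq_addl n D)).
    elim: (D) (Phi') dPhi' => [|m IHm] P dP x Hx; first by rewrite dP ?mulr0.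
    apply: degree_lt_ext (IHm _ (dP x Hx)) => y; rewrite /diff; ring.
  apply: degree_lt_ext (degree_ltD dPhi'b (IHn _ (dh b Logic.I))) => g.
  by rewrite /diff Phi_c Phi_D; ring.
exists (e + D)%N, (Phi f); split.
- exact: degPhi.
- rewrite Phi_c van_f // addr0 mulf_neq0 // subr_eq0; exact/eqP.
- by split; [exact: van_f|exact: van_all].
- by move=> i ic g b; exact: Phi_other.
Qed.

Theorem reduced_separated s : reduced s -> s <> [::] ->
  exists d (Phi : Gamma -> K),
    degree_lt [set: Gamma] d Phi /\ Phi (word_prod s) <> Phi 1.
Proof.
move=> /reduced_coefficient[d [Phi [dPhi /eqP Phis van _]]] s_neq0.
exists d, Phi; split=> // E; apply: Phis; rewrite E.
elim: s s_neq0 van {E} => [//|x [|y u] IHu] _ [] //= Phiu van.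
by apply: IHu.
Qed.

End FreeProductSeparated.

(** * Wreath products *)

Section Wreath.
Variables (X : finType) (Gamma : groupType).

(** [wreath] acts on the right on the set of pairs [(g, x)], with [g] in [Gamma],
    by [(g, x) (c, s) = (g * c x, s x)]. *)
Record wreath := Wreath { wbase : X -> Gamma; wtop : {perm X} }.

HB.instance Definition _ := gen_eqMixin wreath.
HB.instance Definition _ := gen_choiceMixin wreath.

Lemma wreath_eq (a b : wreath) : wbase a =1 wbase b -> wtop a =1 wtop b -> a = b.
Proof. by case: a b => [c s] [c' s'] /= /funext -> /permP ->. Qed.

Definition wreath_mul (a b : wreath) :=
  Wreath (fun x => wbase a x * wbase b (wtop a x)) (wtop a * wtop b).
Definition wreath_one := Wreath (fun=> 1) 1.
Definition wreath_inv (a : wreath) :=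
  Wreath (fun x => (wbase a ((wtop a)^-1 x))^-1) (wtop a)^-1.

Lemma wreath_mulA : associative wreath_mul.
Proof.
by move=> a b c; apply: wreath_eq => x /=; rewrite ?permM ?mulgA // !permM.
Qed.

Lemma wreath_mul1 : left_id wreath_one wreath_mul.
Proof. by move=> a; apply: wreath_eq => x /=; rewrite ?perm1 mul1g. Qed.

Lemma wreath_mulg1 : right_id wreath_one wreath_mul.
Proof. by move=> a; apply: wreath_eq => x /=; rewrite mulg1. Qed.

Lemma wreath_mulV : left_inverse wreath_one wreath_inv wreath_mul.
Proof. by move=> a; apply: wreath_eq => x /=; rewrite ?mulVg. Qed.

Lemma wreath_mulgV : right_inverse wreath_one wreath_inv wreath_mul.
Proof. by move=> a; apply: wreath_eq => x /=; rewrite ?permK mulgV. Qed.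

HB.instance Definition _ := isGroup.Build wreath
  wreath_mulA wreath_mul1 wreath_mulg1 wreath_mulV wreath_mulgV.

Lemma wbaseM (a b : wreath) x : wbase (a * b) x = wbase a x * wbase b (wtop a x).
Proof. by []. Qed.

Lemma wtopM (a b : wreath) : wtop (a * b) = wtop a * wtop b.
Proof. by []. Qed.

End Wreath.

(** * Potentials on spanning trees *)

Section Tree.
Variables (Gamma : finite_graph) (S : groupType) (f : edge Gamma -> S).
Hypothesis f_bar : forall e, f (ebar e) = (f e)^-1.
Implicit Types (F : {set edge Gamma}) (e : edge Gamma) (u v : vertex Gamma).

Definition bar_closed F : Prop := forall e, e \in F -> ebar e \in F.

Definition acyclic F : Prop := forall p, is_circuit p -> ~ {subset p <= F}.

Local Notation step := (fun e e' => (target e == source e') && (e' != ebar e)).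

(** A path without repeated vertices cannot backtrack; [e] is an edge to be put
    in front of it, and the disjunction excludes backtracking there as well. *)
Lemma adjacent_path F p u : path (adjacent_in F) u p -> uniq (u :: p) ->
  exists q, [/\ {subset q <= F}, [seq source e | e <- q] = belast u p &
    forall e, target e = u -> (ebar e \notin F) || (source e \notin u :: p) ->
      path step e q /\ target (last e q) = last u p].
Proof.
elim: p u => [|v p IHp] u /=; first by move=> _ _; exists [::]; split.
move=> /andP[/existsP[g /and3P[Fg /eqP su /eqP tv]] vp] /andP[uvp uniq_vp].
have [q [qF sq qP]] := IHp v vp uniq_vp; exists (g :: q); split.
- by move=> e; rewrite inE => /orP[/eqP ->|/qF].
- by rewrite /= sq su.
move=> e te barP; have [|pq lq] := qP g tv; first by rewrite su uvp orbT.
split=> //=; rewrite te su eqxx pq andbT /=; apply/eqP => eqg.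
move: barP; rewrite -eqg Fg /= -tv eqg /target ebarK.
by rewrite !inE eqxx orbT.
Qed.

(** Otherwise a simple path back to the source of [e] would be closed to a
    circuit by [e]. *)
Lemma acyclic_separates F e : acyclic F -> e \in F -> bar_closed F ->
  ~~ connect (adjacent_in (F :\ e :\ ebar e)) (target e) (source e).
Proof.
move=> acF Fe barF; apply/negP => /connectP[p0 path0 last0].
case: (shortenP path0) last0 => p pathp uniqp _ lastp {p0 path0}.
set F' := F :\ e :\ ebar e.
have sF' x : x \in F' -> x \in F by rewrite !inE => /and3P[].
have [q [qF sq qP]] := adjacent_path pathp uniqp.
have [|pathq lastq] := qP e erefl; first by rewrite !inE eqxx.
apply: (acF (e :: q)); last by move=> x; rewrite inE => /orP[/eqP ->|/qF/sF'].
split=> //=; last first.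
  rewrite sq; move: uniqp; rewrite lastI -lastp rcons_uniq.
  by move=> /andP[-> ->].
rewrite rcons_path pathq /= lastq -lastp eqxx /=; apply/eqP => eqe.
have : last e q \in e :: q by exact: mem_last.
rewrite inE => /orP[/eqP E|/qF]; first by move: (ebar_neq e); rewrite -{1}E -eqe eqxx.
by rewrite !inE -[last e q]ebarK -eqe eqxx.
Qed.

(** Removing [e] and [ebar e] puts the ends of [e] into different components, so
    that a potential for the remaining edges may be multiplied by a constant on
    one of the two components to fit [e]. *)
Lemma acyclic_potential F : bar_closed F -> acyclic F ->
  exists tau : vertex Gamma -> S,
    forall e, e \in F -> f e = (tau (source e))^-1 * tau (target e).
Proof.
have [n] := ubnP #|F|; elim: n F => // n IHn F ltFn barF acF.
have [F0|[e Fe]] := set_0Vmem F.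
  by exists (fun=> 1) => e; rewrite F0 inE.
set F' := F :\ e :\ ebar e.
have sF' x : x \in F' -> x \in F by rewrite !inE => /and3P[].
have F'E x : x \in F -> [\/ x = e, x = ebar e | x \in F'].
  move=> Fx; have [->|xe] := eqVneq x e; first by constructor 1.
  have [->|xbe] := eqVneq x (ebar e); first by constructor 2.
  by constructor 3; rewrite !inE xe xbe.
have barF' : bar_closed F'.
  move=> x; rewrite !inE => /and3P[xbe xe Fx].
  by rewrite barF // (can_eq (@ebarK Gamma)) xe (can2_eq (@ebarK Gamma)
    (@ebarK Gamma)) xbe.
have acF' : acyclic F' by move=> p /acF np pF'; apply: np => x /pF'/sF'.
have [|tau tauP] := IHn F' _ barF' acF'.
  apply: leq_trans (_ : #|F| <= n)%N; last by rewrite -ltnS.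
  apply: proper_card; apply/properP; split; first by apply/fintype.subsetP => x /sF'.
  by exists e; rewrite // !inE eqxx andbF.
have nconn := acyclic_separates acF Fe barF; rewrite -/F' in nconn.
pose C v := connect (adjacent_in F') (target e) v.
have Cadj x : x \in F' -> C (source x) = C (target x).
  move=> F'x; apply/idP/idP => Cx; apply: connect_trans Cx (connect1 _).
    by apply/existsP; exists x; rewrite F'x !eqxx.
  by apply/existsP; exists (ebar x); rewrite barF' //= /target ebarK !eqxx.
pose k := tau (source e) * f e * (tau (target e))^-1.
exists (fun v => if C v then k * tau v else tau v) => x /F'E[->|->|F'x].
- by rewrite /C (negbTE nconn) connect0 /k mulgVK mulKg.
- rewrite f_bar /target ebarK -/(target e) /C connect0 (negbTE nconn) /k mulgVK.
  by rewrite invgM mulgVK.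
- rewrite -Cadj // tauP //; case: ifP => // _.
  by rewrite invgM -mulgA mulKg.
Qed.

Lemma spanning_tree_potential T : spanning_tree T ->
  exists tau : vertex Gamma -> S,
    forall e, e \in T -> f e = (tau (source e))^-1 * tau (target e).
Proof. by case=> barT _ acT; exact: acyclic_potential. Qed.

End Tree.

(** * Numbering the cosets of a finite subgroup *)

Section CosetNumbering.
Variables (R : finGroupType) (D : groupType) (A : D -> R).
Hypotheses (AM : {morph A : x y / x * y}) (A_inj : injective A).

Definition image_set : {set R} := finset (fun x => `[< exists a, A a = x >]).

Lemma image_setP x : reflect (exists a, A a = x) (x \in image_set).
Proof. by rewrite inE; exact: asboolP. Qed.

Lemma image_group_set : group_set image_set.
Proof.
apply/group_setP; split; first by apply/image_setP; exists 1; exact: (morph1g AM).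
move=> _ _ /image_setP[a <-] /image_setP[b <-].
by apply/image_setP; exists (a * b).
Qed.

Canonical image_group := Group image_group_set.

Definition coset_list : seq {set R} := enum (lcosets image_set (setTfor R)).

Definition coset_count : nat := #|setTfor R : image_set|.

Definition coset_num (x : R) : nat := index (x *: image_set) coset_list.

Definition coset_rep (n : nat) : R := fingroup.repr (nth finset.set0 coset_list n).

Definition coset_elt (x : R) : D :=
  xget 1 [set a | x = coset_rep (coset_num x) * A a].

Lemma coset_countE : coset_count = (#|R| %/ #|image_set|)%N.
Proof.
rewrite /coset_count -[#|R|]cardsT.
by rewrite -(@divgS _ [group of setTfor R] image_group) ?finset.subsetT.
Qed.

Lemma size_coset_list : size coset_list = coset_count.
Proof. by rewrite /coset_list -cardE card_lcosets. Qed.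

Lemma mem_coset_list x : x *: image_set \in coset_list.
Proof. by rewrite mem_enum; apply/lcosetsP; exists x; rewrite ?inE. Qed.

Lemma coset_num_lt x : (coset_num x < coset_count)%N.
Proof. by rewrite -size_coset_list index_mem mem_coset_list. Qed.

Lemma coset_rep_coset n : (n < coset_count)%N ->
  coset_rep n *: image_set = nth finset.set0 coset_list n.
Proof.
rewrite -size_coset_list /coset_rep => /(mem_nth finset.set0).
rewrite mem_enum => /lcosetsP[y _ ->]; apply/lcoset_eqP.
exact: (fingroup.mem_repr y (lcoset_refl image_group y)).
Qed.

Lemma coset_numK n a : (n < coset_count)%N -> coset_num (coset_rep n * A a) = n.
Proof.
move=> ltn; rewrite /coset_num.
have -> : (coset_rep n * A a) *: image_set = coset_rep n *: image_set.
  apply/lcoset_eqP; rewrite mem_lcoset mulKg.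
  by apply/image_setP; exists a.
by rewrite coset_rep_coset // index_uniq ?size_coset_list ?enum_uniq.
Qed.

Lemma coset_eltE x : x = coset_rep (coset_num x) * A (coset_elt x).
Proof.
apply: (@xgetPex _ 1 [set a | x = coset_rep (coset_num x) * A a]).
have : x \in coset_rep (coset_num x) *: image_set.
  rewrite coset_rep_coset ?coset_num_lt // nth_index ?mem_coset_list //.
  exact: lcoset_refl.
by move=> /lcosetP[_ /image_setP[a <-] E]; exists a.
Qed.

Lemma coset_eltK n a : (n < coset_count)%N -> coset_elt (coset_rep n * A a) = a.
Proof.
move=> ltn; apply: A_inj; apply: (mulgI (coset_rep n)).
by have := coset_eltE (coset_rep n * A a); rewrite coset_numK.
Qed.

End CosetNumbering.

(** * Words in a graph of groups *)

Section Words.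
Variable GG : graph_of_groups.
Implicit Types (e : edge GG) (v : vertex GG).

(** In a word [g_1 e_1 ... g_n e_n g] a letter is an edge together with the
    element of the vertex group that precedes it; the last element is kept apart,
    so that no letter has to be attached to a missing edge. *)
Definition letter_type := {e : edge GG & vgroup (source e)}.
Definition end_type := {v : vertex GG & vgroup v}.
Implicit Types (w : seq letter_type) (z : end_type).

Fixpoint walk v w z : Prop :=
  if w is x :: w' then source (tag x) = v /\ walk (target (tag x)) w' z
  else tag z = v.

(** By the relations, [e k (ebar e)] is then an element of the vertex group at the
    source of [e]. *)
Definition backtracks e w : Prop :=
  if w is y :: _ then
    tag y = ebar e /\ exists k : egroup (tag y), tagged y = emono (tag y) k
  else False.

Fixpoint reduced_word w : Prop :=
  if w is x :: w' then ~ backtracks (tag x) w' /\ reduced_word w' else True.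

Section Value.
Variables (S : groupType) (F : forall v, vgroup v -> S) (eps : edge GG -> S).
Hypothesis FM : forall v, {morph @F v : g h / g * h}.
Hypothesis eps_bar : forall e, eps e * eps (ebar e) = 1.
Hypothesis eps_emono : forall e (k : egroup e),
  F (emono e k) * eps e = eps e * F (emono (ebar e) (to_ebar k)).

Fixpoint word_val w z : S :=
  if w is x :: w' then F (tagged x) * eps (tag x) * word_val w' z
  else F (tagged z).

End Value.

(** [w'] is [w] with its first element multiplied by [h] on the left; the
    equality of tagged elements avoids a cast along [v = source (tag x)]. *)
Definition head_mul v (h : vgroup v) w w' : Prop :=
  match w, w' with
  | x :: u, x' :: u' => exists h' : vgroup (source (tag x)),
      [/\ u' = u, x' = Tagged (fun e => vgroup (source e)) (h' * tagged x) &
          Tagged (fun v => vgroup v) h' = Tagged (fun v => vgroup v) h]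
  | [::], [::] => True
  | _, _ => False
  end.

Lemma word_lmul v (h : vgroup v) w z : walk v w z -> exists w' z',
  [/\ walk v w' z', tag z' = tag z, size w' = size w, head_mul h w w' &
      forall (S : groupType) (F : forall v, vgroup v -> S) (eps : edge GG -> S),
        (forall v, {morph @F v : g h / g * h}) ->
        word_val F eps w' z' = F v h * word_val F eps w z].
Proof.
case: w => [|[e g] w] /=.
  case: z => u g /= eqv; case: _ / eqv h => h.
  exists [::], (Tagged (fun v => vgroup v) (h * g)); split=> // S F eps FM.
  exact: FM.
case=> eqv walkw; case: _ / eqv h => h.
exists (Tagged (fun e => vgroup (source e)) (h * g) :: w), z; split=> //;
  first by exists h.
by move=> S F eps FM /=; rewrite FM !mulgA.
Qed.

Lemma reduced_word_head_mul v (h : vgroup v) w w' :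
  head_mul h w w' -> reduced_word w -> reduced_word w'.
Proof. by case: w w' => [|x w] [|x' w'] //= [h' [-> -> _]]. Qed.

Lemma backtracks_head_mul e (k : egroup (ebar e)) w w' :
  head_mul (emono (ebar e) k) w w' -> backtracks e w' -> backtracks e w.
Proof.
case: w w' => [|[e2 g] w] [|x' w'] //= [h' [_ -> /= eqh]] [eq2 [k2 /= eqg]].
split=> //; move: g h' eqh k2 eqg; rewrite eq2 => g h' eqh k2 eqg.
have {}eqh : h' = emono (ebar e) k by apply: eq_from_Tagged eqh.
exists (k^-1 * k2); apply: (mulgI h'); rewrite eqg eqh gmulfM (morphVg (@gmulfM _ _ _)).
by rewrite mulVKg.
Qed.

Section Reduction.
Variables (S : groupType) (F : forall v, vgroup v -> S) (eps : edge GG -> S).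
Hypothesis FM : forall v, {morph @F v : g h / g * h}.
Hypothesis eps_bar : forall e, eps e * eps (ebar e) = 1.
Hypothesis eps_emono : forall e (k : egroup e),
  F (emono e k) * eps e = eps e * F (emono (ebar e) (to_ebar k)).

(** A backtrack along [e] collapses to an element of the vertex group, which is
    absorbed by the next letter; this creates no new backtrack, since whether a
    letter starts one does not depend on its vertex group element. *)
Lemma word_reduce w z v : walk v w z -> exists w' z',
  [/\ walk v w' z', tag z' = tag z, reduced_word w' &
      word_val F eps w' z' = word_val F eps w z].
Proof.
elim: w v => [|[e g] u IHu] v /=; first by move=> zv; exists [::], z.
case=> eqv /IHu[u1 [z1 [walk1 tag1 red1 val1]]].
have [back|nback] := pselect (backtracks e u1); last first.
  by exists (Tagged (fun e => vgroup (source e)) g :: u1), z1; split=> //=;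
    rewrite val1.
case: u1 back walk1 red1 val1 =>
  // -[e2 g2] u2 [/= eq2 [k eqg2]] [_ walk2] [_ red2] val2.
move: g2 k eqg2 walk2 val2; rewrite eq2 => _ k -> walk2 val2.
have [u3 [z3 [walk3 tag3 _ mul3 val3]]] :=
  word_lmul (emono (ebar (ebar e)) (to_ebar k)) walk2.
have walk3' : walk (source e) u3 z3 by rewrite /target ebarK in walk3.
have [u4 [z4 [walk4 tag4 _ mul4 val4]]] := word_lmul g walk3'.
exists u4, z4; split; first by rewrite -eqv.
- by rewrite tag4 tag3.
- exact: reduced_word_head_mul mul4 (reduced_word_head_mul mul3 red2).
rewrite val4 // val3 // -val2 !mulgA; congr (_ * _).
by rewrite -!mulgA eps_emono !mulgA -[_ * eps e * _]mulgA eps_bar mulg1.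
Qed.

End Reduction.

End Words.

Section Pi1.
Variables (GG : graph_of_groups) (T : {set edge GG}).
Hypothesis T_tree : spanning_tree T.
Implicit Types (e : edge GG) (v : vertex GG).

Local Notation rels := (pi1_relators T).

Definition pi1_vertex v (g : vgroup v) : pi1 T := quotient_pi rels (vertex_elt g).
Definition pi1_edge e : pi1 T := quotient_pi rels (edge_elt e).

Lemma pi1_vertexM v : {morph @pi1_vertex v : g h / g * h}.
Proof.
move=> g h; rewrite /pi1_vertex /vertex_elt free_product_inM.
exact: quotient_pi_morph.
Qed.

Lemma pi1_edge_bar e : pi1_edge e * pi1_edge (ebar e) = 1.
Proof.
rewrite -[LHS](quotient_pi_morph rels); apply: quotient_pi_rel.
by left; left; exists e.
Qed.

Lemma pi1_edge_tree e : e \in T -> pi1_edge e = 1.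
Proof. by move=> Te; apply: quotient_pi_rel; left; right; exists e. Qed.

Lemma pi1_edge_emono e (k : egroup e) :
  pi1_vertex (emono e k) * pi1_edge e = pi1_edge e * pi1_vertex (emono (ebar e)
    (to_ebar k)).
Proof.
have qM := @quotient_pi_morph _ rels.
have : quotient_pi rels ((edge_elt e)^-1 * vertex_elt (emono e k) * edge_elt e
          * (vertex_elt (emono (ebar e) (to_ebar k)))^-1) = 1.
  by apply: quotient_pi_rel; right; exists e, k.
rewrite !qM !(morphVg qM) => /divg1_eq E.
by apply: (mulgI (pi1_edge e)^-1); rewrite mulKg mulgA; exact: E.
Qed.

Lemma pi1_edgeV e : (pi1_edge e)^-1 = pi1_edge (ebar e).
Proof. by apply: (mulgI (pi1_edge e)); rewrite mulgV pi1_edge_bar. Qed.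

Lemma pi1_ind (P : pi1 T -> Prop) : P 1 ->
    (forall x v (g : vgroup v), P x -> P (x * pi1_vertex g)) ->
    (forall x e, P x -> P (x * pi1_edge e)) ->
  forall x, P x.
Proof.
move=> P1 PV PE x; rewrite -[x]quotient_reprK.
have qM := @quotient_pi_morph _ rels.
elim/free_product_ind: (repr x) => [|y [v|] g IHy]; first by rewrite (morph1g qM).
  by rewrite qM; exact: PV.
rewrite -[g]free_reprK.
elim/last_ind: (repr g) => [|w [e b] IHw].
  by rewrite [X in _ * X](_ : _ = 1) ?mulg1 //;
    exact: (@free_product_in1 _ (@factor GG) None).
rewrite -cats1 free_piM.
have := @free_product_inM _ (@factor GG) None (free_pi w) (free_pi [:: (e, b)]) => ->.
rewrite mulgA qM; case: b; first exact: PE.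
have -> : quotient_pi rels (@free_product_in _ (@factor GG) None (free_pi [:: (e,
  false)]))
   = (pi1_edge e)^-1.
  rewrite -(morphVg qM) -[(edge_elt e)^-1](@free_product_inV _ (@factor GG) None).
  by congr (quotient_pi _ (free_product_in _)); exact: (free_piV [:: (e, true)]).
by rewrite pi1_edgeV; exact: PE.
Qed.

Lemma pi1_lift (S : groupType) (F : forall v, vgroup v -> S) (eps : edge GG -> S) :
    (forall v, {morph @F v : g h / g * h}) ->
    (forall e, eps e * eps (ebar e) = 1) ->
    (forall e, e \in T -> eps e = 1) ->
    (forall e (k : egroup e),
       F _ (emono e k) * eps e = eps e * F _ (emono (ebar e) (to_ebar k))) ->
  exists rho : pi1 T -> S, [/\ {morph rho : x y / x * y},
    forall v (g : vgroup v), rho (pi1_vertex g) = F v g &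
    forall e, rho (pi1_edge e) = eps e].
Proof.
move=> FM eps_bar eps_tree eps_emono; have [rho0 rho0M rho0E] := free_group_lift eps.
pose F' i : factor i -> S := match i with Some v => F v | None => rho0 end.
have [|rho1 rho1M rho1E] := @free_product_lift _ (@factor GG) S F'.
  by case=> [v|]; [exact: FM|exact: rho0M].
have rho1V v (g : vgroup v) : rho1 (vertex_elt g) = F v g.
  exact: (rho1E (Some v)).
have rho1e e : rho1 (edge_elt e) = eps e.
  by rewrite -rho0E; exact: (rho1E None).
have [|rho rhoM rhoE] := @quotient_lift _ _ rels rho1 rho1M.
  move=> r [[[e _ <-]|[t Tt <-]]|[e [k ->]]].
  - by rewrite rho1M !rho1e.
  - by rewrite rho1e eps_tree.
  - rewrite !rho1M !(morphVg rho1M) !rho1V !rho1e -!mulgA (mulgA (F _ _)) eps_emono.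
    by rewrite !mulgA mulVg mul1g mulgV.
exists rho; split=> // [v g|e]; first by rewrite [LHS]rhoE rho1V.
by rewrite [LHS]rhoE rho1e.
Qed.

Local Notation val := (word_val pi1_vertex pi1_edge).

Lemma word_rmul v0 v (g : vgroup v) w z : walk v0 w z -> tag z = v ->
  exists z', [/\ tag z' = v, walk v0 w z' & val w z' = val w z * pi1_vertex g].
Proof.
case: z => u h + /= equ; case: _ / equ g => g walkw.
exists (Tagged (fun v => vgroup v) (h * g)).
elim: w v0 walkw => [|x w IHw] v0 /=; first by split=> //; exact: pi1_vertexM.
by case=> eqv /IHw[_ walkw ->]; split=> //; rewrite mulgA.
Qed.

Lemma word_append v w z e : walk v w z -> source e = tag z ->
  exists w' z', [/\ walk v w' z', tag z' = target e & val w' z' = val w z * pi1_edge e].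
Proof.
case: z => u g /= + equ; case: _ / equ g => g walkw.
exists (rcons w (Tagged (fun e => vgroup (source e)) g)).
exists (Tagged (fun v => vgroup v) (1 : vgroup (target e))).
elim: w v walkw => [|x w IHw] v /=.
  by move=> eqv; split=> //; rewrite (morph1g (@pi1_vertexM _)) mulg1.
by case=> eqv /IHw[walkw tagw ->]; split=> //; rewrite mulgA.
Qed.

(** Every element is the value of a walk between any two given vertices, as the
    edges of the spanning tree are trivial in the fundamental group. *)
Lemma pi1_word v0 x u :
  exists w z, [/\ walk v0 w z, tag z = u & val w z = x].
Proof.
have [_ T_conn _] := T_tree.
have move_end w z : walk v0 w z -> forall u, exists w' z',
    [/\ walk v0 w' z', tag z' = u & val w' z' = val w z].
  move=> walkw {}u; have /connectP[p pathp ->] := T_conn (tag z) u.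
  elim: p w z walkw pathp => [|v p IHp] w z walkw /=; first by exists w, z.
  case/andP=> /existsP[t /and3P[Tt /eqP st /eqP tt]] pathp.
  have [w' [z' [walk' tag' val']]] := word_append walkw st.
  rewrite -tt -tag' in pathp *.
  have [w2 [z2 [walk2 tag2 val2]]] := IHp w' z' walk' pathp.
  by exists w2, z2; split=> //; rewrite val2 val' pi1_edge_tree ?mulg1.
elim/pi1_ind: x u => [|x v g IHx|x e IHx] u.
- have [|w [z [walkw tagw valw]]] := move_end [::] (Tagged (fun v =>
  vgroup v) (1 : vgroup v0)) _ u.
    by [].
  by exists w, z; split=> //; rewrite valw /= (morph1g (@pi1_vertexM _)).
- have [w [z [walkw tagw valw]]] := IHx v.
  have [z' [tag' walk' val']] := word_rmul g walkw tagw.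
  have [w2 [z2 [walk2 tag2 val2]]] := move_end _ _ walk' u.
  by exists w2, z2; split=> //; rewrite val2 val' valw.
- have [w [z [walkw tagw valw]]] := IHx (source e).
  have [w' [z' [walk' tag' val']]] := word_append walkw (esym tagw).
  have [w2 [z2 [walk2 tag2 val2]]] := move_end _ _ walk' u.
  by exists w2, z2; split=> //; rewrite val2 val' valw.
Qed.

Lemma pi1_fingen : (forall v : vertex GG, finitely_generated (vgroup v)) ->
  fingen [set: pi1 T].
Proof.
move=> fgV; have gen v : exists l : seq (pi1 T),
    forall g : vgroup v, generated [set` l] (pi1_vertex g).
  have [s defs] := finitely_generated_fingen (fgV v).
  exists [seq pi1_vertex g | g <- s] => g.
  have sgA := generated_subgroup [set` [seq pi1_vertex g | g <- s]].
  have : [set: vgroup v] g by [].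
  rewrite defs; move: g; apply: (generated_min (L :=
    [set g | generated _ (pi1_vertex g)])).
    split=> [|x y /= gx gy|x /= gx].
    - by rewrite /= (morph1g (@pi1_vertexM _)); exact: (subgroup1 sgA).
    - by rewrite pi1_vertexM; exact: (subgroupM sgA).
    - by rewrite (morphVg (@pi1_vertexM _)); exact: (subgroupV sgA).
  by move=> g /= sg; apply: sub_generated; rewrite /= map_f.
have [l lP] := choice gen.
pose s := flatten [seq l v | v <- enum (vertex GG)] ++ [seq pi1_edge e | e <- enum
  (edge GG)].
exists s; apply/seteqP; split=> // x _; have sgs := generated_subgroup [set` s].
elim/pi1_ind: x => [|x v g IHx|x e IHx]; first exact: (subgroup1 sgs).
- apply: (subgroupM sgs IHx); move: (lP v g); apply: generated_min => // y /= ly.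
  apply: sub_generated; rewrite /= mem_cat; apply/orP; left.
  by apply/flattenP; exists (l v); rewrite // map_f // mem_enum.
- apply: (subgroupM sgs IHx); apply: sub_generated; rewrite /= mem_cat; apply/orP;
  right.
  by rewrite map_f // mem_enum.
Qed.

End Pi1.

(** * Kernels as groups *)

Section Kernel.
Variables (G R : groupType) (f : G -> R) (fM : {morph f : x y / x * y}).

(** A free factor has to be a type; the index [fM] lets the group structure be
    inferred. *)
Record kernel (fM : {morph f : x y / x * y}) :=
  Kernel { kval : G; kvalP : f kval = 1 }.

HB.instance Definition _ := gen_eqMixin (kernel fM).
HB.instance Definition _ := gen_choiceMixin (kernel fM).

Lemma kval_inj : injective (@kval fM).
Proof.
by case=> x xP [y yP] /= eqxy; case: _ / eqxy yP => yP; congr Kernel;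
  exact: Prop_irrelevance.
Qed.

Lemma kernelM (x y : kernel fM) : f (kval x * kval y) = 1.
Proof. by rewrite fM !kvalP mulg1. Qed.
Lemma kernelV (x : kernel fM) : f (kval x)^-1 = 1.
Proof. by rewrite (morphVg fM) kvalP invg1. Qed.

Definition kernel_mul (x y : kernel fM) := @Kernel fM _ (kernelM x y).
Definition kernel_one := @Kernel fM _ (morph1g fM).
Definition kernel_inv (x : kernel fM) := @Kernel fM _ (kernelV x).

Lemma kernel_mulA : associative kernel_mul.
Proof. by move=> x y z; apply: kval_inj; rewrite /= mulgA. Qed.
Lemma kernel_mul1 : left_id kernel_one kernel_mul.
Proof. by move=> x; apply: kval_inj; rewrite /= mul1g. Qed.
Lemma kernel_mulg1 : right_id kernel_one kernel_mul.
Proof. by move=> x; apply: kval_inj; rewrite /= mulg1. Qed.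
Lemma kernel_mulV : left_inverse kernel_one kernel_inv kernel_mul.
Proof. by move=> x; apply: kval_inj; rewrite /= mulVg. Qed.
Lemma kernel_mulgV : right_inverse kernel_one kernel_inv kernel_mul.
Proof. by move=> x; apply: kval_inj; rewrite /= mulgV. Qed.

HB.instance Definition _ := isGroup.Build (kernel fM)
  kernel_mulA kernel_mul1 kernel_mulg1 kernel_mulV kernel_mulgV.

Lemma kernel_separated (K : zmodType) :
  separated K [set x | f x = 1] -> separated K [set: kernel fM].
Proof.
move=> sepN x _ x1; have x1' : kval x <> 1 by move=> E; apply: x1; exact: kval_inj.
have [d [F [dF Fx]]] := sepN (kval x) (kvalP x) x1'.
exists d, (F \o @kval fM); split=> //.
by apply: degree_lt_comp dF => // [y _]; exact: kvalP.
Qed.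

End Kernel.

(** * The cocycle of a finite action *)

Section Cocycle.
Variables (G : groupType) (R : finGroupType) (f : G ->
  R) (fM : {morph f : x y / x * y}).

(** [G] acts on [R] on the right through [f]. The set from which [base x] is
    chosen is the orbit of [x], so that [base] is constant on orbits. *)
Definition base (x : R) : R := xget 1 [set y | exists g, y = x * f g].
Definition sect (x : R) : G := xget 1 [set g | x = base x * f g].

Lemma baseM x g : base (x * f g) = base x.
Proof.
rewrite /base; congr (xget _ _); apply/seteqP; split=> _ [h ->].
  by exists (g * h); rewrite fM mulgA.
by exists (g^-1 * h); rewrite fM (morphVg fM) mulgA mulgK.
Qed.

Lemma sectP x : x = base x * f (sect x).
Proof.
apply: (@xgetPex _ 1 [set g | x = base x * f g]).
have [g ->] : [set y | exists g, y = x * f g] (base x).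
  by apply: xgetPex; exists x, 1; rewrite (morph1g fM) mulg1.
by exists g^-1; rewrite /= (morphVg fM) mulgK.
Qed.

Lemma cocycle_ker x g : f (sect x * g * (sect (x * f g))^-1) = 1.
Proof.
rewrite !fM (morphVg fM); apply: (mulgI (base x)).
have E := sectP (x * f g); rewrite baseM in E.
by rewrite mulg1 !mulgA -sectP {1}E mulgK.
Qed.

Definition cocycle x g : kernel fM := Kernel fM (cocycle_ker x g).

Lemma cocycleM x g h : cocycle x (g * h) = cocycle x g * cocycle (x * f g) h.
Proof.
by apply: kval_inj; rewrite /= fM !mulgA mulgVK.
Qed.

(** [G] acts freely on the pairs [(k, x)] with [k] in the kernel and [x] in [R],
    by [(k, x) g = (k * cocycle x g, x * f g)], since every orbit is a copy of
    [G] acting on itself. *)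
Lemma cocycle_eq1 x g : cocycle x g = 1 -> x * f g = x -> g = 1.
Proof.
move=> /(congr1 (@kval _ _ _ fM)) /= + eqx; rewrite eqx => E.
by apply: (mulgI (sect x)); apply: (mulIg (sect x)^-1); rewrite E mulg1 mulgV.
Qed.

End Cocycle.

(** * The wreath product representation *)

Section EdgeCast.
Variable GG : graph_of_groups.
Implicit Type e : edge GG.

Let cast (K K' : groupType) (E : K' = K) (g : K) : K' :=
  eq_rect_r (fun K : groupType => K : Type) g E.

Lemma to_ebarM e : {morph @to_ebar GG e : g h / g * h}.
Proof.
rewrite /to_ebar; move: (egroup_bar e); move: (egroup (ebar e)) => K E.
by case: _ / (esym E) (E) => E' g h; rewrite (Prop_irrelevance E' erefl).
Qed.

Lemma to_ebarK e (k : egroup e) :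
  Tagged (fun e => egroup e) (to_ebar (to_ebar k)) = Tagged (fun e => egroup e) k.
Proof.
have castK (K1 K2 K3 : groupType) (p : K2 = K1) (q : K3 = K2) (g : K1) :
    cast q (cast p g) = cast (etrans q p) g.
  by case: _ / p g => g; case: _ / q g.
have castE e' (E : e' = e) (q : egroup e' = egroup e) :
    Tagged (fun e => egroup e) (cast q k) = Tagged (fun e => egroup e) k.
  by case: _ / (esym E) q => q; rewrite (Prop_irrelevance q erefl).
by rewrite /to_ebar -/(cast _ _) [cast _ (cast _ _)]castK castE // ebarK.
Qed.

Lemma to_ebar_inj e : injective (@to_ebar GG e).
Proof.
move=> k k' eqk; apply: (@eq_from_Tagged _ (fun e => egroup e)).
by rewrite -(to_ebarK k) eqk to_ebarK.
Qed.

End EdgeCast.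

Section Representation.
Variables (GG : graph_of_groups) (K : finFieldType) (R : finGroupType).
Variable pi : forall v : vertex GG, vgroup v -> R.
Hypothesis piM : forall v, {morph @pi v : g h / g * h}.
Hypothesis pi_inj : forall e : edge GG, injective (fun k => pi (emono e k)).
Implicit Types (e : edge GG) (v : vertex GG).

(** The free factors are the kernels at the vertices, and for each edge and coset
    number a copy of the additive group of [K], in which [1] marks the crossing of
    the edge; any group with a nontrivial separated element would do. *)
Definition colour : choiceType := (vertex GG + edge GG * nat)%type.
Definition colour_group (i : colour) : groupType :=
  match i with inl v => kernel (@piM v) | inr _ => K end.
Local Notation Gamma := (free_product colour_group).

Definition vertex_syl v (x : kernel (@piM v)) : Gamma :=
  @free_product_in _ colour_group (inl v) x.
Definition edge_syl e n (a : K) : Gamma :=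
  @free_product_in _ colour_group (inr (e, n)) a.

Definition vertex_base v x g : Gamma := vertex_syl (cocycle (@piM v) x g).
Definition vertex_act v (g : vgroup v) : wreath R Gamma :=
  Wreath (fun x => vertex_base x g) (perm (@mulIg R (pi g))).

Lemma vertex_baseM v x (g h : vgroup v) :
  vertex_base x (g * h) = vertex_base x g * vertex_base (x * pi g) h.
Proof. by rewrite /vertex_base cocycleM /vertex_syl free_product_inM. Qed.

Lemma vertex_actM v : {morph @vertex_act v : g h / g * h}.
Proof.
move=> g h; apply: wreath_eq => x; first by rewrite wbaseM /= permE vertex_baseM.
by rewrite wtopM permM !permE piM mulgA.
Qed.

Definition edge_map e (k : egroup e) : R := pi (emono e k).

Lemma edge_mapM e : {morph @edge_map e : k l / k * l}.
Proof. by move=> k l; rewrite /edge_map gmulfM piM. Qed.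

Lemma edge_map_inj e : injective (@edge_map e). Proof. exact: pi_inj. Qed.

Local Notation num e := (coset_num (@edge_map e)).
Local Notation rep e := (coset_rep (@edge_map e)).
Local Notation elt e := (coset_elt (@edge_map e)).
Local Notation count e := (coset_count (@edge_map e)).

Lemma image_set_bar e : #|image_set (@edge_map (ebar e))| = #|image_set (@edge_map e)|.
Proof.
have le e' : (#|image_set (@edge_map e')| <= #|image_set (@edge_map (ebar e'))|)%N.
  pose inv x : egroup e' := xget 1 [set k | edge_map k = x].
  have invK k : inv (edge_map k) = k.
    apply: (@edge_map_inj e').
    exact: (@xgetI _ 1 [set k' | edge_map k' = edge_map k] k).
  rewrite -(card_in_imset (f := fun x => edge_map (to_ebar (inv x)))); last first.
    move=> _ _ /image_setP[k <-] /image_setP[l <-]; rewrite !invK.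
    by move=> /edge_map_inj/to_ebar_inj ->.
  apply: subset_leq_card; apply/fintype.subsetP => _ /imsetP[_ /image_setP[k <-] ->].
  by rewrite invK; apply/image_setP; exists (to_ebar k).
by apply/eqP; rewrite eqn_leq le andbT; have := le (ebar e); rewrite ebarK.
Qed.

Lemma count_bar e : count (ebar e) = count e.
Proof.
by rewrite (coset_countE (@edge_mapM _)) image_set_bar -(coset_countE (@edge_mapM _)).
Qed.

Definition edge_next e x : R := rep (ebar e) (num e x) * edge_map (to_ebar (elt e x)).

(** At a coset representative the value is the quotient of the elements marking
    the two sides of [e], and equivariance under the edge group determines it
    elsewhere. A quotient, rather than one marker per edge, makes crossing
    [ebar e] inverse to crossing [e] without choosing orientations, and keeps the
    squares of a crossing reduced even though the markers have finite order. *)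
Definition edge_base e x : Gamma :=
  (vertex_base (rep e (num e x)) (emono e (elt e x)))^-1
  * edge_syl e (num e x) 1%R * (edge_syl (ebar e) (num e x) 1%R)^-1
  * vertex_base (rep (ebar e) (num e x)) (emono (ebar e) (to_ebar (elt e x))).

Lemma num_next e x : num (ebar e) (edge_next e x) = num e x.
Proof.
by rewrite /edge_next coset_numK ?count_bar //;
  [exact: edge_mapM|exact: coset_num_lt (@edge_mapM _) _].
Qed.

Lemma elt_next e x : elt (ebar e) (edge_next e x) = to_ebar (elt e x).
Proof.
rewrite /edge_next coset_eltK ?count_bar //.
- exact: edge_mapM.
- exact: edge_map_inj.
- exact: coset_num_lt (@edge_mapM _) _.
Qed.

Lemma edge_nextK e : cancel (edge_next e) (edge_next (ebar e)).
Proof.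
move=> x; rewrite /edge_next -/(edge_next e x) num_next elt_next.
pose P (t : {e : edge GG & egroup e}) := rep (tag t) (num e x) * edge_map (tagged t).
have := congr1 P (to_ebarK (elt e x)); rewrite /P /= => ->.
exact/esym/(coset_eltE (@edge_mapM e)).
Qed.

Definition edge_act e : wreath R Gamma :=
  Wreath (edge_base e) (perm (can_inj (edge_nextK e))).

Lemma edge_act_bar e : edge_act e * edge_act (ebar e) = 1.
Proof.
apply: wreath_eq => x; last first.
  by rewrite wtopM permM !permE edge_nextK.
rewrite wbaseM /= permE /edge_base num_next elt_next.
pose P (t : {e : edge GG & egroup e}) :=
  vertex_base (rep (tag t) (num e x)) (emono (tag t) (tagged t)).
have := congr1 P (to_ebarK (elt e x)); rewrite /P /= => ->.
by rewrite ebarK !mulgA mulgK mulgVK mulgK mulVg.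
Qed.

Lemma edge_act_emono e (k : egroup e) :
  vertex_act (emono e k) * edge_act e
    = edge_act e * vertex_act (emono (ebar e) (to_ebar k)).
Proof.
have eqx x := coset_eltE (@edge_mapM e) x.
have numM x : num e (x * edge_map k) = num e x.
  by rewrite {1}(eqx x) -mulgA -edge_mapM coset_numK //;
    [exact: edge_mapM|exact: coset_num_lt (@edge_mapM _) _].
have eltM x : elt e (x * edge_map k) = elt e x * k.
  rewrite {1}(eqx x) -mulgA -edge_mapM coset_eltK //.
  - exact: edge_mapM.
  - exact: edge_map_inj.
  - exact: coset_num_lt (@edge_mapM _) _.
apply: wreath_eq => x; last first.
  rewrite !wtopM !permM !permE /= /edge_next -/(edge_map k) numM eltM.
  by rewrite to_ebarM edge_mapM mulgA.
rewrite !wbaseM /= !permE /edge_base -/(edge_map k) numM eltM.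
rewrite to_ebarM !gmulfM !vertex_baseM -/(edge_map _) -/(edge_map _) -eqx.
rewrite invgM !mulgA mulgV mul1g.
by rewrite /edge_next.
Qed.

Local Notation val := (word_val vertex_act edge_act).
Local Notation word := (seq (syllable colour_group)).

Lemma append_letter i (a : colour_group i) (s : word) : reduced s ->
  last_colour_neq i s ->
  exists s', [/\ reduced s', word_prod s' = word_prod s * free_product_in a,
    a = 1 -> s' = s & a <> 1 -> s' = Tagged colour_group a :: s].
Proof.
move=> red_s col_s; have [a1|a1] := pselect (a = 1).
  by exists s; split=> //; rewrite a1 free_product_in1 mulg1.
by exists (Tagged colour_group a :: s).
Qed.

(** Acting on [x], a reduced word of the graph of groups produces a reduced word
    of the free product. Crossing [e] contributes the two letters of the colours
    [(e, n)] and [(ebar e, n)], so that cancellation between two crossings can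
    only occur if the second is along [ebar e] and through the same coset [n],
    with trivial cocycle in between. The element of the vertex group in between
    then differs from one of the edge group by an element that fixes a point of
    the free action on pairs, so it is in the edge group. *)
Lemma walk_coefficient w z v x (s : word) :
    walk v w z -> reduced_word w -> reduced s -> last_colour_neq (inl v : colour) s ->
    (if w is y :: _ then forall n (k : egroup (tag y)),
        x * pi (tagged y) = rep (tag y) n * edge_map k ->
        cocycle (@piM _) x (tagged y * (emono (tag y) k)^-1) = 1 ->
        last_colour_neq (inr (tag y, n) : colour) s
     else True) ->
  exists s', [/\ reduced s', word_prod s * wbase (val w z) x = word_prod s' &
    s' = [::] -> [/\ w = [::], s = [::] & cocycle (@piM (tag z)) x (tagged z) = 1]].
Proof.
have [m] := ubnP (size w); elim: m w z v x s => // m IHm [|[e g] w] z v x s /=.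
  move=> _ <- _ red_s col_s _.
  have [s' [red' prod' s'1 s'n1]] :=
    @append_letter (inl (tag z)) (cocycle (@piM _) x (tagged z)) s red_s col_s.
  exists s'; split=> //.
  have [c1|/s'n1 -> //] := pselect (cocycle (@piM (tag z)) x (tagged z) = 1).
  by rewrite s'1.
rewrite ltnS => ltwm [<- walkw] [nback red_w] red_s col_s head_s.
set y := x * pi g; set n := num e y; set k := elt e y.
have eqy : y = rep e n * edge_map k by exact: (coset_eltE (@edge_mapM e)).
set c := cocycle (@piM (source e)) x (g * (emono e k)^-1).
have [s1 [red1 prod1 s1E s1E']] := @append_letter (inl (source e)) c s red_s col_s.
have K1 : (1%R : K) <> 1 :> colour_group (inr (e, n)).
  by apply/eqP; exact: GRing.oner_neq0.
have K1' : ((1%R : K)^-1 : colour_group (inr (ebar e, n))) <> 1.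
  by move=> /eqP; rewrite invg_eq1; apply/negP; exact: GRing.oner_neq0.
have col1 : last_colour_neq (inr (e, n) : colour) s1.
  have [c1|c1] := pselect (c = 1); last by rewrite s1E'.
  by rewrite s1E //; exact: (head_s n k eqy c1).
pose s2 : word := Tagged colour_group ((1%R : K) : colour_group (inr (e, n))) :: s1.
pose s3 : word := Tagged colour_group (((1%R : K)^-1) : colour_group (inr (ebar e,
  n))) :: s2.
have red3 : reduced s3.
  by split=> //=; apply/eqP => -[/eqP]; rewrite (negbTE (ebar_neq e)).
have [w' [z' [walk' tag' size' mul' val']]] :=
  word_lmul (emono (ebar e) (to_ebar k)) walkw.
have [||s' [red' prod' s'0]] := IHm w' z' (target e) (rep (ebar e) n) s3 _ walk'
  (reduced_word_head_mul mul' red_w) red3 isT.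
- by rewrite size'.
- move: (backtracks_head_mul mul') {val' walk' size'};
  case: w' mul' => // -[e2 g2] w' _ back /= n2 k2 eqx c2.
  apply/eqP => -[eq2 eqn]; apply: nback; apply: back => /=; split=> //.
  exists k2; apply/divg1_eq/(cocycle_eq1 c2).
  by rewrite piM mulgA eqx (morphVg (@piM _)) -/(edge_map _) mulgK eqn eq2.
exists s'; split=> //; last by case/s'0.
rewrite -prod' val' //; last exact: vertex_actM.
have base_g : vertex_base x g
    = vertex_base x (g * (emono e k)^-1) * vertex_base (rep e n) (emono e k).
  rewrite -{1}(mulgVK (emono e k) g) vertex_baseM; congr (_ * vertex_base _ _).
  by rewrite piM mulgA -/y eqy (morphVg (@piM _)) -/(edge_map _) mulgK.
rewrite permM !permE -/y base_g /edge_base -/n -/k.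
rewrite wbaseM /= permE prod1 free_product_inV -/(edge_next e y).
by rewrite !mulgA mulgK.
Qed.

End Representation.

(** * The fundamental group is virtually separated *)

Lemma field_separated (K : finFieldType) : separated K [set: K].
Proof.
move=> h _ h1; exists 2%N, (id : K -> K); split=> // x _ y _ z _.
by rewrite /diff !FinRing.zmodMgE; ring.
Qed.

Section CoreSeparated.
Variables (GG : graph_of_groups) (T : {set edge GG}).
Hypothesis T_tree : spanning_tree T.
Variables (K : finFieldType) (R : finGroupType) (pi : forall v : vertex GG,
  vgroup v -> R).
Hypothesis piM : forall v, {morph @pi v : g h / g * h}.
Hypothesis pi_inj : forall e : edge GG, injective (fun k => pi (emono e k)).
Hypothesis sep_ker : forall v, separated K [set g | @pi v g = 1].

Local Notation rho_val := (word_val (vertex_act K piM) (edge_act K piM pi_inj)).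

(** The core acts trivially on [R], so that on it each coordinate of the wreath
    product is a homomorphism to the free product, along which polynomial
    functions are pulled back. The potential [tau] conjugates the action so that
    the edges of the spanning tree act trivially. *)
Lemma pi1_core_separated : separated K (hom_core {perm R} [set: pi1 T]).
Proof.
have /card_gt0P[v0 _] := vertex_nonempty GG.
set f := edge_act K piM pi_inj; have f_bar e : f (ebar e) = (f e)^-1.
  by apply: (mulgI (f e)); rewrite mulgV; exact: edge_act_bar.
have [tau tauP] := spanning_tree_potential f_bar T_tree.
pose om v (g : vgroup v) := vertex_act K piM g.
have omM v : {morph @om v : g h / g * h} by exact: vertex_actM.
have [||||rho [rhoM rhoV rhoE]] := @pi1_lift _ T _ (fun v g =>
  tau v * om v g * (tau v)^-1)
    (fun e => tau (source e) * f e * (tau (target e))^-1).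
- by move=> v g h; rewrite omM !mulgA mulgVK.
- move=> e; rewrite /target ebarK -/(target e) f_bar !mulgA mulgVK mulgK.
  by rewrite mulgV.
- by move=> e Te; rewrite tauP // mulKVg mulgV.
- move=> e k; rewrite /target !mulgA !mulgVK -!mulgA; congr (_ * _).
  rewrite !mulgA; congr (_ * _).
  exact: edge_act_emono.
pose psi x := (tau v0)^-1 * rho x * tau v0.
have psiM : {morph psi : x y / x * y}.
  by move=> x y; rewrite /psi rhoM !mulgA mulgK.
have rho_word w z v : walk v w z ->
    rho (word_val (@pi1_vertex _ T) (pi1_edge T) w z)
      = tau v * rho_val w z * (tau (tag z))^-1.
  elim: w v => [|x w IHw] v /=; first by move=> <-; rewrite rhoV.
  by case=> <- /IHw walkw; rewrite !rhoM rhoV rhoE walkw !mulgA !mulgVK.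
have sgcore : is_subgroup (hom_core {perm R} [set: pi1 T]).
  exact: hom_core_subgroup.
have top_core x : hom_core {perm R} [set: pi1 T] x -> wtop (psi x) = 1.
  by case=> _ /(_ (fun x => wtop (psi x))); apply=> y z _ _; rewrite psiM wtopM.
move=> h core_h h1; have [w0 [z0 [walk0 tag0 val0]]] := pi1_word T_tree v0 h v0.
have [w [z [walkw tagw red_w valw]]] :=
  word_reduce (@pi1_vertexM _ T) (pi1_edge_bar T) (@pi1_edge_emono _ T) walk0.
have {val0}valw : word_val (@pi1_vertex _ T) (pi1_edge T) w z = h by rewrite valw.
have psi_h : psi h = rho_val w z.
  by rewrite /psi -valw (rho_word _ _ _ walkw) tagw tag0 !mulgA mulVg mul1g mulgVK.
have [s [red_s prod_s s0]] :=
    @walk_coefficient _ K R pi piM pi_inj w z v0 1 [::] walkw red_w Logic.I isT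
      (ltac:(by case: (w))).
have sN0 : s <> [::].
  move=> /s0[w0' _ c1]; apply: h1; rewrite -valw w0' /=.
  suff -> : tagged z = 1 by exact: (morph1g (@pi1_vertexM _ T _)).
  apply: (cocycle_eq1 c1); have := top_core h core_h.
  by rewrite psi_h w0' /= => /permP/(_ 1); rewrite permE perm1.
have sepH i : separated K [set: colour_group K piM i].
  by case: i => [v|b]; [exact: kernel_separated|exact: field_separated].
have [d [Phi [dPhi Phi_s]]] := reduced_separated sepH red_s sN0.
exists d, (fun x => Phi (wbase (psi x) 1)); split; last first.
  by rewrite psi_h -[wbase _ 1]mul1g prod_s (morph1g psiM).
apply: (degree_lt_comp (f := fun x => wbase (psi x) 1)) dPhi => // x y core_x core_y.
by rewrite psiM wbaseM top_core // perm1.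
Qed.

End CoreSeparated.

Lemma perm_embed (X Y : finType) (i : X -> Y) : injective i ->
  exists2 theta : {perm X} -> {perm Y}, {morph theta : s t / s * t} & injective theta.
Proof.
move=> i_inj; pose act (s : {perm X}) y :=
  if [pick x | i x == y] is Some x then i (s x) else y.
have act_i s x : act s (i x) = i (s x).
  by rewrite /act; case: pickP => [x' /eqP/i_inj ->//|/(_ x)]; rewrite eqxx.
have act_out s y : (forall x, i x != y) -> act s y = y.
  by move=> out; rewrite /act; case: pickP => // x; rewrite (negbTE (out x)).
have actM s t y : act (s * t) y = act t (act s y).
  case: (pickP (fun x => i x == y)) => [x /eqP <-|out]; first by rewrite !act_i permM.
  have {}out x : i x != y by rewrite out.
  by rewrite !act_out.
have act1 y : act 1 y = y.
  case: (pickP (fun x => i x == y)) => [x /eqP <-|out]; first by rewrite act_i perm1.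
  by rewrite act_out // => x; rewrite out.
have actI s : injective (act s).
  by apply: (can_inj (g := act s^-1)) => y; rewrite -actM mulgV act1.
exists (fun s => perm (actI s)) => [s t|s t /permP eqst].
  by apply/permP => y; rewrite permM !permE actM.
by apply/permP => x; apply: i_inj; rewrite -!act_i; have := eqst (i x); rewrite !permE.
Qed.

Lemma finite_order (D : groupType) (x : D) :
  finite_set [set: D] -> exists2 n, (0 < n)%N & x ^+ n = 1.
Proof.
move=> /finite_seqP[s defs].
have mem i : (index (x ^+ i) s < size s)%N.
  by rewrite index_mem; have : [set: D] (x ^+ i) by []; rewrite defs.
have [i [j [ltij _ eqv]]] := pigeonhole (fun i => Ordinal (mem i)).
exists (j - i)%N; first by rewrite subn_gt0.
apply: (mulgI (x ^+ i)); rewrite -expgnDr subnKC ?(ltnW ltij) // mulg1.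
have mem' k : x ^+ k \in s by rewrite -index_mem.
have /= eqi := congr1 val eqv.
by rewrite -(nth_index 1 (mem' i)) eqi nth_index.
Qed.

(** Fixed points are added to make the vertex groups act on sets of the same
    size, hence through the same finite group. *)
Lemma exists_separating_action (GG : graph_of_groups) (K L : finFieldType) :
    (forall v : vertex GG, virtually_separated K L [set: vgroup v]) ->
  exists (R : finGroupType) (pi : forall v : vertex GG, vgroup v -> R),
    forall v, [/\ {morph @pi v : g h / g * h},
      separated K [set g | @pi v g = 1] & separated L [set g | @pi v g = 1]].
Proof.
move=> sepV; have bound (v : vertex GG) : exists n, forall m, (n <= m)%N ->
    exists pi : vgroup v -> {perm 'I_m}, [/\ {morph pi : g h / g * h},
      separated K [set g | pi g = 1] & separated L [set g | pi g = 1]].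
  have [V [sgV sV finV sepK sepL]] := sepV v.
  have [X [pi [piM piV]]] := fin_index_hom (@subgroupT (vgroup v)) sgV sV finV.
  exists #|X| => m leXm.
  have i_inj : injective (fun x : X => widen_ord leXm (enum_rank x)).
    by move=> x y /(congr1 val) /= /val_inj/enum_rank_inj.
  have [theta thetaM theta_inj] := perm_embed i_inj.
  have kerV : [set g | theta (pi g) = 1] `<=` V.
    by move=> g /=; rewrite -(morph1g thetaM) => /theta_inj; exact: piV.
  exists (theta \o pi); split; [|exact: separated_sub sepK|exact: separated_sub sepL].
  by move=> g h /=; rewrite piM // thetaM.
have [n nP] := choice bound.
have pi_ex v := cid (nP v (\max_v n v) (leq_bigmax v)).
exists {perm 'I_(\max_v n v)}, (fun v => sval (pi_ex v)) => v.
exact: svalP (pi_ex v).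
Qed.

Theorem pi1_virtually_separated (GG : graph_of_groups) (T : {set edge GG})
    (p q : nat) (K L : finFieldType) :
    p \in [pchar K]%R -> q \in [pchar L]%R -> p != q -> spanning_tree T ->
    (forall v : vertex GG, finitely_generated (vgroup v)) ->
    (forall v : vertex GG, virtually_nilpotent (vgroup v)) ->
    (forall e : edge GG, finite_set [set: egroup e]) ->
  exists R : finGroupType, separated K (hom_core R [set: pi1 T]) /\
                           separated L (hom_core R [set: pi1 T]).
Proof.
move=> chK chL pq T_tree fgV nilV finE.
have sepV v := virtually_nilpotent_separated chK chL (fgV v) (nilV v).
have [R [pi piP]] := exists_separating_action sepV.
have piM v : {morph @pi v : g h / g * h} by case: (piP v).
have sepK v : separated K [set g | @pi v g = 1] by case: (piP v).
have sepL v : separated L [set g | @pi v g = 1] by case: (piP v).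
(* The kernel of [pi] is torsion-free, so it meets the finite edge group trivially. *)
have pi_inj e : injective (fun k : egroup e => pi _ (emono e k)).
  move=> k l eqkl; apply/esym/eqP; rewrite -[l](mulVKg k) -[X in _ == X]mulg1.
  apply/eqP; congr (_ * _); set x := k^-1 * l.
  have [n n_gt0 xn] := finite_order x (finE e).
  apply: (@emono_inj _ e); rewrite (morph1g (@gmulfM _ _ (emono e))).
  have sgker : is_subgroup [set g | pi (source e) g = 1].
    split=> /= [|g h pg ph|g pg]; first exact: morph1g (piM _).
      by rewrite piM pg ph mulg1.
    by rewrite (morphVg (piM _)) pg invg1.
  apply: (separated_torsion_free chK chL pq sgker (sepK _) (sepL _) _ n_gt0).
    rewrite /= gmulfM piM (morphVg (@gmulfM _ _ (emono e))) (morphVg (piM _)).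
    by rewrite eqkl mulVg.
  have <- : emono e (x ^+ n) = emono e x ^+ n.
    elim: (n) => [|m IHm]; first exact: (morph1g (@gmulfM _ _ (emono e))).
    by rewrite !expgS gmulfM IHm.
  by rewrite xn (morph1g (@gmulfM _ _ (emono e))).
by exists {perm R}; split; exact: pi1_core_separated.
Qed.

Theorem corollary5p2 (GG : graph_of_groups) (T : {set edge GG})
    (T_tree : spanning_tree T)
    (vgroup_fg : forall v : vertex GG, finitely_generated (vgroup v))
    (vgroup_vnil : forall v : vertex GG, virtually_nilpotent (vgroup v))
    (egroup_fin : forall e : edge GG, finite_set [set: egroup e])
    (phi : UMagmaMorphism.type (pi1 T) (pi1 T)) :
  exists R : nat, (0 < R)%N /\
    forall x : pi1 T, Per phi x -> exists2 n : nat, is_period phi x n & (n <= R)%N.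
Proof.
have ch2 : 2%N \in [pchar 'F_2]%R by exact: pchar_Fp.
have ch3 : 3%N \in [pchar 'F_3]%R by exact: pchar_Fp.
have [Q [sep2 sep3]] := pi1_virtually_separated ch2 ch3 isT T_tree vgroup_fg
  vgroup_vnil egroup_fin.
have fgG := pi1_fingen T vgroup_fg.
have phiM : {morph phi : x y / (x * y)%g} by exact: gmulfM.
have sgT := fingen_subgroup fgG.
have [|R R_gt0 RP] := bounded_periods ch2 ch3 isT fgG (hom_core_subgroup Q sgT)
    (hom_core_fin_index Q fgG) phiM _ sep2 sep3.
  by apply: hom_core_stable => // x y _ _; exact: phiM.
exists R; split=> // x [n /= n_gt0 xn].
have per : exists n, (0 < n)%N && (iter n phi x == x).
  by exists n; rewrite n_gt0; apply/eqP.
case: (ex_minnP per) => m /andP[m_gt0 /eqP xm] m_min; exists m.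
  by split=> // k k_gt0 xk; apply: m_min; rewrite k_gt0; apply/eqP.
by apply: m_min; rewrite R_gt0; apply/eqP; exact: RP xn.
Qed.
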